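(* Finite conjunctive query entailment for $\mathrm{GF}^2_{pres}$ is decidable: given a $\mathrm{GF}^2_{pres}$ sentence $\varphi$ and a conjunctive query $q$, it is decidable whether every finite model of $\varphi$ satisfies $q$.
   Context: Structures are over relational signatures with unary and binary relation symbols and equality. The guarded fragment $\mathrm{GF}$ is the smallest set of first-order formulas containing all relational atoms and equalities between variables, closed under Boolean connectives, and such that if $\psi(\bar x,\bar y)\in\mathrm{GF}$ and $\gamma(\bar x,\bar y)$ is a relational atom containing all free variables of $\psi$, then $\forall\bar y\,(\gamma\to\psi)$ and $\exists\bar y\,(\gamma\wedge\psi)$ are in $\mathrm{GF}$. A local Presburger quantifier is $\sum_{i=1}^n\lambda_i\cdot\#^{r_i}_y[\varphi_i(x,y)]\circledast\delta$ with integers $\lambda_i,\delta$, $r_i\in\{R,R^-\}$ for binary $R$, $\circledast\in\{=,\neq,\le,\ge,<,>,\equiv_d,\not\equiv_d\}$; $\mathcal{M},x/a$ satisfies it iff $\sum_i\lambda_i\cdot|\{b:\mathcal{M}\models r_i(a,b)\wedge\varphi_i(a,b)\}|\circledast\delta$, where $R^-(a,b)$ means $R(b,a)$. $\mathrm{GF}_{pres}$ extends $\mathrm{GF}$ by closing under such quantifiers (with $\varphi_i$ formulas of the logic with free variables among $x,y$); $\mathrm{GF}^2_{pres}$ is its two-variable fragment. A conjunctive query is a finite conjunction of atoms $r(u,v)$ ($r$ binary) and $A(u)$ ($A$ unary) over variables; a structure $\mathcal{A}$ satisfies $q$ if some assignment of the variables of $q$ to elements of $\mathcal{A}$ makes all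 atoms true. *)

(* Defs.v *)
From mathcomp Require Import all_boot all_order all_algebra.
Set Implicit Arguments. Unset Strict Implicit. Unset Printing Implicit Defensive.
Import Order.TTheory GRing.Theory Num.Theory.

(* Syntax of GF^2_pres.  Relation symbols are indexed by nat (unary   *)
(* and binary symbols live in separate namespaces).  The two          *)
(* variables x, y are represented by [bool] (false = x, true = y).    *)

Definition var := bool.

Inductive gatom : Type :=
| AU (A : nat) (u : var)
| AB (R : nat) (u v : var).

Inductive cmp : Type :=
| CEq | CNeq | CLe | CGe | CLt | CGt
| CCong (d : nat) | CNCong (d : nat).

Inductive gpform : Type :=
| FU (A : nat) (u : var)
| FB (R : nat) (u v : var)
| FEq (u v : var)
| FNeg (f : gpform)
| FAnd (f g : gpform)
| FEx (vs : seq var) (g : gatom) (f : gpform)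
| FCount (v : var) (ts : pterms) (c : cmp) (delta : int)
    (* sum_i lam_i * #^{r_i}_{w}[phi_i(v,w)]  c  delta, where w = ~~ v *)
with pterms : Type :=
| PNil
| PCons (lam : int) (R : nat) (inv : bool) (f : gpform) (ts : pterms).
    (* term lam * #^{r}_w [f], r = R if inv = false, r = R^- if inv = true *)

(* Guarded universal quantification is expressed through negation:
   forall vs (g -> f)  :=  FNeg (FEx vs g (FNeg f)); likewise disjunction. *)

Definition atom_has (g : gatom) (w : var) : bool :=
  match g with AU _ u => w == u | AB _ u v => (w == u) || (w == v) end.

Fixpoint fv (f : gpform) (w : var) : bool :=
  match f with
  | FU _ u => w == u
  | FB _ u v => (w == u) || (w == v)
  | FEq u v => (w == u) || (w == v)
  | FNeg f => fv f w
  | FAnd f g => fv f w || fv g w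
  | FEx vs g f => (atom_has g w || fv f w) && (w \notin vs)
  | FCount v _ _ _ => w == v
  end.

Fixpoint is_gf (f : gpform) : bool :=
  match f with
  | FU _ _ | FB _ _ _ | FEq _ _ => true
  | FNeg f => is_gf f
  | FAnd f g => is_gf f && is_gf g
  | FEx vs g f => is_gf f && [forall w : bool, fv f w ==> atom_has g w]
  | FCount _ ts _ _ => is_gf_terms ts
  end
with is_gf_terms (ts : pterms) : bool :=
  match ts with
  | PNil => true
  | PCons _ _ _ f ts => is_gf f && is_gf_terms ts
  end.

Definition gf2pres_sentence (f : gpform) : bool :=
  is_gf f && [forall w : bool, ~~ fv f w].

Section Semantics.
Variables (D : finType) (U : nat -> pred D) (B : nat -> rel D).

Definition upd (e : var -> D) (v : var) (d : D) : var -> D :=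
  fun w => if w == v then d else e w.

Definition atom_sat (e : var -> D) (g : gatom) : bool :=
  match g with AU A u => U A (e u) | AB R u v => B R (e u) (e v) end.

Fixpoint exv (vs : seq var) (e : var -> D) (P : (var -> D) -> bool) : bool :=
  match vs with
  | [::] => P e
  | v :: vs' => [exists d : D, exv vs' (upd e v d) P]
  end.

Definition cmp_sat (c : cmp) (s delta : int) : bool :=
  match c with
  | CEq => s == delta
  | CNeq => s != delta
  | CLe => (s <= delta)%R
  | CGe => (s >= delta)%R
  | CLt => (s < delta)%R
  | CGt => (s > delta)%R
  | CCong d => (s == delta %[mod d%:Z])%Z
  | CNCong d => (s != delta %[mod d%:Z])%Z
  end.

Definition role (R : nat) (inv : bool) (a b : D) : bool :=
  if inv then B R b a else B R a b.

Fixpoint sat (e : var -> D) (f : gpform) {struct f} : bool :=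
  match f with
  | FU A u => U A (e u)
  | FB R u v => B R (e u) (e v)
  | FEq u v => e u == e v
  | FNeg f => ~~ sat e f
  | FAnd f g => sat e f && sat e g
  | FEx vs g f => exv vs e (fun e' => atom_sat e' g && sat e' f)
  | FCount v ts c delta => cmp_sat c (psum e v ts) delta
  end
with psum (e : var -> D) (v : var) (ts : pterms) {struct ts} : int :=
  match ts with
  | PNil => 0%R
  | PCons lam R inv f ts =>
      (lam * (#|[pred b : D | role R inv (e v) b && sat (upd e (~~ v) b) f]|)%:Z
      + psum e v ts)%R
  end.

Inductive cq_atom : Type :=
| QU (A : nat) (u : nat)
| QB (R : nat) (u v : nat).

Definition cq_atom_sat (h : nat -> D) (a : cq_atom) : bool :=
  match a with QU A u => U A (h u) | QB R u v => B R (h u) (h v) end.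

Definition cq_sat (q : seq cq_atom) : Prop :=
  exists h : nat -> D, all (cq_atom_sat h) q.

End Semantics.

Arguments QU : clear implicits.
Arguments QB : clear implicits.

Definition cq := seq cq_atom.

Definition finite_entails (f : gpform) (q : cq) : Prop :=
  forall (D : finType) (U : nat -> pred D) (B : nat -> rel D),
    0 < #|D| -> (forall e : var -> D, sat U B e f) -> cq_sat U B q.

Inductive rf : Type :=
| RZero
| RSucc
| RProj (i : nat)
| RComp (f : rf) (gs : seq rf)
| RPrec (f g : rf)
| RMu (f : rf).

Inductive eval : rf -> seq nat -> nat -> Prop :=
| ev_zero xs : eval RZero xs 0
| ev_succ x xs : eval RSucc (x :: xs) x.+1
| ev_proj i xs : eval (RProj i) xs (nth 0 xs i)
| ev_comp f gs xs ys z :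
    evals gs xs ys -> eval f ys z -> eval (RComp f gs) xs z
| ev_prec0 f g xs z : eval f xs z -> eval (RPrec f g) (0 :: xs) z
| ev_precS f g n xs y z :
    eval (RPrec f g) (n :: xs) y -> eval g (n :: y :: xs) z ->
    eval (RPrec f g) (n.+1 :: xs) z
| ev_mu f xs n :
    eval f (n :: xs) 0 ->
    (forall m, m < n -> exists k, eval f (m :: xs) k.+1) ->
    eval (RMu f) xs n
with evals : seq rf -> seq nat -> seq nat -> Prop :=
| evs_nil xs : evals [::] xs [::]
| evs_cons g gs xs y ys :
    eval g xs y -> evals gs xs ys -> evals (g :: gs) xs (y :: ys).

(* Standard Goedel encoding of the input (Cantor pairing).            *)

Definition cpair (a b : nat) : nat := ((a + b) * (a + b).+1) %/ 2 + b.

Fixpoint enc_list (l : seq nat) : nat :=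
  match l with [::] => 0 | x :: l => (cpair x (enc_list l)).+1 end.

Definition enc_int (z : int) : nat :=
  match z with Posz n => n.*2 | Negz n => n.*2.+1 end.

Definition enc_var (v : var) : nat := nat_of_bool v.

Definition enc_atom (g : gatom) : nat :=
  match g with
  | AU A u => cpair 0 (cpair A (enc_var u))
  | AB R u v => cpair 1 (cpair R (cpair (enc_var u) (enc_var v)))
  end.

Definition enc_cmp (c : cmp) : nat :=
  match c with
  | CEq => cpair 0 0 | CNeq => cpair 1 0 | CLe => cpair 2 0
  | CGe => cpair 3 0 | CLt => cpair 4 0 | CGt => cpair 5 0
  | CCong d => cpair 6 d | CNCong d => cpair 7 d
  end.

Fixpoint enc_form (f : gpform) : nat :=
  match f with
  | FU A u => cpair 0 (cpair A (enc_var u))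
  | FB R u v => cpair 1 (cpair R (cpair (enc_var u) (enc_var v)))
  | FEq u v => cpair 2 (cpair (enc_var u) (enc_var v))
  | FNeg f => cpair 3 (enc_form f)
  | FAnd f g => cpair 4 (cpair (enc_form f) (enc_form g))
  | FEx vs g f =>
      cpair 5 (cpair (enc_list (map enc_var vs)) (cpair (enc_atom g) (enc_form f)))
  | FCount v ts c delta =>
      cpair 6 (cpair (enc_var v)
        (cpair (enc_terms ts) (cpair (enc_cmp c) (enc_int delta))))
  end
with enc_terms (ts : pterms) : nat :=
  match ts with
  | PNil => 0
  | PCons lam R inv f ts =>
      (cpair (enc_int lam)
        (cpair R (cpair (nat_of_bool inv) (cpair (enc_form f) (enc_terms ts))))).+1
  end.

Definition enc_cq_atom (a : cq_atom) : nat :=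
  match a with
  | QU A u => cpair 0 (cpair A u)
  | QB R u v => cpair 1 (cpair R (cpair u v))
  end.

Definition enc_cq (q : cq) : nat := enc_list (map enc_cq_atom q).

(* Main.v *)
From mathcomp Require Import all_boot all_order all_algebra all_fingroup zify ring.
From Stdlib Require Import FunctionalExtensionality Classical_Prop.
Require Import Defs.
Set Implicit Arguments. Unset Strict Implicit. Unset Printing Implicit Defensive.

(* A finite countermodel of size at most a computable function of the codes of
   the formula and the query can be found by exhaustive search, so everything
   rests on bounding countermodels.  Let D be any finite countermodel.  Classify
   its elements by the truth values of all subformulas, refined n times by the
   classes of the neighbours, where n exceeds the size of the query.  The
   numbers of neighbours of an element, per edge label and class, obey linear
   constraints that fix the truth values of the Presburger quantifiers, and the
   edges leaving one class for another balance globally.  These are linear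
   Diophantine systems.  Every solution of such a system is a sum of bounded
   ones, so a bounded family of elements realises all constraints that occur in
   D.  Its half-edges can be matched into a multigraph, whose finite cover with
   voltages in a group of permutations of short words is a simple graph with
   the same degrees and girth above n.  The cover satisfies the same guarded
   formulas as D, and as a match of the query meets only a forest, it can be
   folded back into D along the classes.  Hence the cover is a countermodel,
   too. *)

(** * Computable functions *)

(** The refinement of classes records which labels and classes occur among the neighbours, not how
    often, so the number of classes is bounded in advance although the degrees in D are not;
    multiplicities enter only through the linear systems. This works because a guarded subformula
    with both variables free matters only at equal or adjacent elements, where the classes and the
    label of the pair decide it. A Presburger sum at an element is therefore a linear form in its
    numbers of neighbours per label and class, and edges may be redistributed as long as these
    numbers suit. Redistribution can create short cycles that D lacks, and with them new matches of
    the query; hence the large girth. Folding a forest back into D costs one level of refinement per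
    vertex, which ties the depth of the refinement to the size of the query. A single number above
    both codes bounds symbols, subformulas, coefficients, moduli, query atoms and query variables,
    so every size is an explicit function of it. *)

Definition Cf (k : nat) (F : (nat -> nat) -> nat) : Prop :=
  exists M, forall e, eval M (mkseq e k) (F e).

Definition Cp k (P : (nat -> nat) -> bool) := Cf k (fun e => P e : nat).

Lemma Cf_ext k F G : (forall e, F e = G e) -> Cf k F -> Cf k G.
Proof. by move=> FG [M HM]; exists M => e; rewrite -FG. Qed.

Lemma Cf_var k i : i < k -> Cf k (fun e => e i).
Proof.
move=> lt_ik; exists (RProj i) => e.
by rewrite -(nth_mkseq 0 e lt_ik); apply: ev_proj.
Qed.

(** In environment style, composition of machines is substitution: bodies written with [e 0], [e 1],
    ... act as open terms with de Bruijn variables. The list of machines is built from its end, over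
    the suffixes of [iota 0 n]. *)
Lemma Cf_subst n k G (Fs : nat -> (nat -> nat) -> nat) :
  Cf n G -> (forall i, i < n -> Cf k (Fs i)) -> Cf k (fun e => G (fun i => Fs i e)).
Proof.
move=> [M HM] HF.
suff [gs Hgs] : exists gs, forall e, evals gs (mkseq e k) (mkseq (fun i => Fs i e) n).
  by exists (RComp M gs) => e; apply: ev_comp (Hgs e) (HM _).
have: forall m, m <= n -> exists gs, forall e,
    evals gs (mkseq e k) [seq Fs i e | i <- iota (n - m) m].
  elim=> [|m IHm] le_mn; first by exists [::] => e; apply: evs_nil.
  have [gs Hgs] := IHm (ltnW le_mn).
  have [g Hg] := HF (n - m.+1) ltac:(lia).
  exists (g :: gs) => e /=; apply: evs_cons => //.
  by have -> : (n - m.+1).+1 = n - m by lia.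
by move=> /(_ n (leqnn n)); rewrite subnn.
Qed.

Lemma Cf_app1 k f F : Cf 1 (fun e => f (e 0)) -> Cf k F -> Cf k (fun e => f (F e)).
Proof. by move=> Hf HF; apply: (Cf_subst (Fs := fun _ => F) Hf) => -[]. Qed.

Lemma Cf_app2 k f F G :
  Cf 2 (fun e => f (e 0) (e 1)) -> Cf k F -> Cf k G -> Cf k (fun e => f (F e) (G e)).
Proof.
move=> Hf HF HG.
by apply: (Cf_subst (Fs := fun i => if i is 0 then F else G) Hf) => -[|[]].
Qed.

Lemma Cf_app3 k f F G H :
  Cf 3 (fun e => f (e 0) (e 1) (e 2)) -> Cf k F -> Cf k G -> Cf k H ->
  Cf k (fun e => f (F e) (G e) (H e)).
Proof.
move=> Hf HF HG HH.
by apply: (Cf_subst (Fs := fun i => match i with 0 => F | 1 => G | _ => H end) Hf)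
  => -[|[|[]]].
Qed.

Lemma Cf_app4 k f F G H I :
  Cf 4 (fun e => f (e 0) (e 1) (e 2) (e 3)) -> Cf k F -> Cf k G -> Cf k H -> Cf k I ->
  Cf k (fun e => f (F e) (G e) (H e) (I e)).
Proof.
move=> Hf HF HG HH HI.
by apply: (Cf_subst
  (Fs := fun i => match i with 0 => F | 1 => G | 2 => H | _ => I end) Hf)
  => -[|[|[|[]]]].
Qed.

Lemma Cf_S k F : Cf k F -> Cf k (fun e => (F e).+1).
Proof.
apply: Cf_app1; exists (RComp RSucc [:: RProj 0]) => e.
apply: (@ev_comp _ _ _ [:: e 0]); last exact: ev_succ.
by apply: evs_cons (evs_nil _); apply: ev_proj.
Qed.

Lemma Cf_const k n : Cf k (fun=> n).
Proof.
elim: n => [|n IHn]; last exact: (Cf_S IHn).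
by exists RZero => e; apply: ev_zero.
Qed.

(* The step function sees the counter and the previous value as the two
   innermost variables, which shifts the ambient environment by two. *)
Lemma Cf_rec k F (G : nat -> nat -> (nat -> nat) -> nat) N :
  Cf k F -> Cf k.+2 (fun e => G (e 0) (e 1) (fun i => e i.+2)) -> Cf k N ->
  Cf k (fun e => nat_rec (fun=> nat) (F e) (fun i acc => G i acc e) (N e)).
Proof.
move=> [MF HF] [MG HG] HN.
pose H e := nat_rec (fun=> nat) (F (fun i => e i.+1))
  (fun i acc => G i acc (fun i => e i.+1)) (e 0).
have HH : Cf k.+1 H.
  exists (RPrec MF MG) => e; rewrite /H /mkseq /=.
  have -> : [seq e i | i <- iota 1 k] = mkseq (fun i => e i.+1) k.
    by rewrite -[1]addn0 iotaDl -map_comp.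
  elim: (e 0) => [|n IHn] /=; first by apply: ev_prec0; apply: HF.
  apply: (ev_precS IHn).
  have := HG (fun i => match i with 0 => n | 1 => nat_rec (fun=> nat)
    (F (fun i => e i.+1)) (fun i acc => G i acc (fun i => e i.+1)) n
    | i.+2 => e i.+1 end).
  rewrite /mkseq /=.
  have -> : iota 2 k = map (addn 2) (iota 0 k) by rewrite -iotaDl addn0.
  by rewrite -map_comp.
apply: (Cf_ext (F := fun e => H (fun i => if i is j.+1 then e j else N e))) => //.
apply: (Cf_subst (Fs := fun i e => if i is j.+1 then e j else N e) HH) => -[|i] // lt_ik.
exact: Cf_var.
Qed.

Lemma Cf_iter k (G : nat -> (nat -> nat) -> nat) F N :
  Cf k F -> Cf k.+1 (fun e => G (e 0) (fun i => e i.+1)) -> Cf k N ->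
  Cf k (fun e => iter (N e) (fun x => G x e) (F e)).
Proof.
move=> HF HG HN; apply: Cf_ext; last apply: (Cf_rec (G := fun _ x e => G x e) HF _ HN).
  by move=> e /=; elim: (N e) => //= n ->.
apply: (Cf_subst (Fs := fun i e => e i.+1) HG) => i lt_ik; exact: Cf_var.
Qed.

Ltac cvar := cbn beta; solve [apply: Cf_var; exact isT].

Lemma Cf_add k F G : Cf k F -> Cf k G -> Cf k (fun e => F e + G e).
Proof.
apply: Cf_app2; apply: (Cf_ext (F := fun e => iter (e 0) S (e 1))).
  by move=> e; rewrite iter_succn addnC.
by apply: (Cf_iter (G := fun x _ => x.+1)); [cvar | apply: Cf_S; cvar | cvar].
Qed.

Lemma Cf_mul k F G : Cf k F -> Cf k G -> Cf k (fun e => F e * G e).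
Proof.
apply: Cf_app2; apply: (Cf_ext (F := fun e => iter (e 0) (fun x => x + e 1) 0)).
  by move=> e; elim: (e 0) => //= n ->; rewrite mulSn addnC.
apply: (Cf_iter (G := fun x e => x + e 1)); first exact: Cf_const.
  by apply: Cf_add; cvar.
cvar.
Qed.

Lemma Cf_exp k F G : Cf k F -> Cf k G -> Cf k (fun e => F e ^ G e).
Proof.
apply: Cf_app2; apply: (Cf_ext (F := fun e => iter (e 1) (fun x => x * e 0) 1)).
  by move=> e; elim: (e 1) => //= n ->; rewrite expnS mulnC.
apply: (Cf_iter (G := fun x e => x * e 0)); first exact: Cf_const.
  by apply: Cf_mul; cvar.
cvar.
Qed.

Lemma Cf_pred k F : Cf k F -> Cf k (fun e => (F e).-1).
Proof.
apply: Cf_app1.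
apply: (Cf_ext (F := fun e => nat_rec (fun=> nat) 0 (fun i _ => i) (e 0))).
  by move=> e; case: (e 0).
by apply: (Cf_rec (G := fun i _ _ => i)); [exact: Cf_const | cvar | cvar].
Qed.

Lemma Cf_sub k F G : Cf k F -> Cf k G -> Cf k (fun e => F e - G e).
Proof.
apply: Cf_app2; apply: (Cf_ext (F := fun e => iter (e 1) predn (e 0))).
  by move=> e; rewrite iter_predn.
by apply: (Cf_iter (G := fun x _ => x.-1)); [cvar | apply: Cf_pred; cvar | cvar].
Qed.

Lemma Cp_eq0 k F : Cf k F -> Cp k (fun e => F e == 0).
Proof.
move=> HF; apply: (Cf_ext (F := fun e => 1 - F e)); first by move=> e; case: (F e).
by apply: Cf_sub => //; apply: Cf_const.
Qed.

Lemma Cp_neg k P : Cp k P -> Cp k (fun e => ~~ P e).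
Proof.
move=> HP; apply: (Cf_ext (F := fun e => 1 - P e)); first by move=> e; case: (P e).
by apply: Cf_sub => //; apply: Cf_const.
Qed.

Lemma Cp_and k P Q : Cp k P -> Cp k Q -> Cp k (fun e => P e && Q e).
Proof.
move=> HP HQ; apply: (Cf_ext (F := fun e => P e * Q e)); first by move=> e; rewrite mulnb.
exact: Cf_mul.
Qed.

Lemma Cp_or k P Q : Cp k P -> Cp k Q -> Cp k (fun e => P e || Q e).
Proof.
move=> HP HQ; apply: (Cf_ext (F := fun e => ~~ (~~ P e && ~~ Q e))).
  by move=> e; case: (P e) (Q e) => [] [].
by apply: Cp_neg; apply: Cp_and; apply: Cp_neg.
Qed.

Lemma Cp_leq k F G : Cf k F -> Cf k G -> Cp k (fun e => F e <= G e).
Proof. by move=> HF HG; apply: Cp_eq0; apply: Cf_sub. Qed.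

Lemma Cp_eq k F G : Cf k F -> Cf k G -> Cp k (fun e => F e == G e).
Proof.
move=> HF HG; apply: (Cf_ext (F := fun e => (F e <= G e) && (G e <= F e))).
  by move=> e; rewrite eqn_leq.
by apply: Cp_and; apply: Cp_leq.
Qed.

Lemma Cf_if k P F G : Cp k P -> Cf k F -> Cf k G -> Cf k (fun e => if P e then F e else G e).
Proof.
move=> HP HF HG; apply: (Cf_ext (F := fun e => P e * F e + ~~ P e * G e)).
  by move=> e; case: (P e); rewrite /= ?mul1n ?mul0n ?addn0.
by apply: Cf_add; apply: Cf_mul => //; apply: Cp_neg.
Qed.

Lemma Cp_if k P Q R : Cp k P -> Cp k Q -> Cp k R -> Cp k (fun e => if P e then Q e else R e).
Proof.
move=> HP HF HG; apply: Cf_ext (Cf_if HP HF HG) => e; by case: (P e).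
Qed.

Lemma Cp_const k b : Cp k (fun=> b).
Proof. exact: Cf_const. Qed.

Lemma Cf_bool k P : Cp k P -> Cf k (fun e => P e : nat).
Proof. by []. Qed.

Lemma Cf_sum k N (F : nat -> (nat -> nat) -> nat) :
  Cf k N -> Cf k.+1 (fun e => F (e 0) (fun i => e i.+1)) ->
  Cf k (fun e => \sum_(0 <= i < N e) F i e).
Proof.
move=> HN HF; apply: Cf_ext;
  last apply: (Cf_rec (G := fun i x e => x + F i e) (Cf_const k 0) _ HN).
  move=> e /=; elim: (N e) => [|n /= ->]; first by rewrite big_geq.
  by rewrite big_nat_recr.
apply: Cf_add; first cvar.
apply: (Cf_subst (Fs := fun i e => if i is 0 then e 0 else e i.+1) HF) => -[|i] lt_ik;
  exact: Cf_var.
Qed.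

Lemma Cf_prod k N (F : nat -> (nat -> nat) -> nat) :
  Cf k N -> Cf k.+1 (fun e => F (e 0) (fun i => e i.+1)) ->
  Cf k (fun e => \prod_(0 <= i < N e) F i e).
Proof.
move=> HN HF; apply: Cf_ext;
  last apply: (Cf_rec (G := fun i x e => x * F i e) (Cf_const k 1) _ HN).
  move=> e /=; elim: (N e) => [|n /= ->]; first by rewrite big_geq.
  by rewrite big_nat_recr.
apply: Cf_mul; first cvar.
apply: (Cf_subst (Fs := fun i e => if i is 0 then e 0 else e i.+1) HF) => -[|i] lt_ik;
  exact: Cf_var.
Qed.

Lemma Cp_has k N (P : nat -> (nat -> nat) -> bool) :
  Cf k N -> Cp k.+1 (fun e => P (e 0) (fun i => e i.+1)) ->
  Cp k (fun e => has (fun i => P i e) (iota 0 (N e))).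
Proof.
move=> HN HP; apply: (Cf_ext (F := fun e => 0 < \sum_(0 <= i < N e) P i e)).
  move=> e; congr nat_of_bool; rewrite /index_iota subn0.
  by elim: (iota _ _) => [|i s IHs]; rewrite ?big_nil //= big_cons addn_gt0 IHs lt0b.
by apply: Cp_leq; [exact: Cf_const | exact: Cf_sum].
Qed.

Lemma Cp_all k N (P : nat -> (nat -> nat) -> bool) :
  Cf k N -> Cp k.+1 (fun e => P (e 0) (fun i => e i.+1)) ->
  Cp k (fun e => all (fun i => P i e) (iota 0 (N e))).
Proof.
move=> HN HP.
apply: (Cf_ext (F := fun e => ~~ has (fun i => ~~ P i e) (iota 0 (N e)))).
  by move=> e; rewrite -all_predC; congr nat_of_bool; apply: eq_all => i /=; rewrite negbK.
by apply: Cp_neg; apply: (Cp_has (P := fun i e => ~~ P i e)) => //; apply: Cp_neg.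
Qed.

(** The position of the first hit is the number of initial segments without a hit, so bounded search
    reduces to a sum. *)
Lemma find_iota0 (P : pred nat) n :
  find P (iota 0 n) = \sum_(0 <= i < n) ~~ has P (iota 0 i.+1).
Proof.
elim: n => [|n IHn]; first by rewrite big_geq.
have -> : iota 0 n.+1 = iota 0 n ++ [:: n] by rewrite -addn1 iotaD.
rewrite big_nat_recr ?leq0n // -IHn find_cat.
have -> : iota 0 n.+1 = iota 0 n ++ [:: n] by rewrite -addn1 iotaD.
rewrite has_cat size_iota [has P [:: n]]/= orbF.
case: ifP => h /=; first by rewrite addn0.
have /hasNfind -> := negbT h.
by rewrite size_iota; case: (P n).
Qed.

Lemma Cf_find k N (P : nat -> (nat -> nat) -> bool) :
  Cf k N -> Cp k.+1 (fun e => P (e 0) (fun i => e i.+1)) ->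
  Cf k (fun e => find (fun i => P i e) (iota 0 (N e))).
Proof.
move=> HN HP; apply: Cf_ext.
  by move=> e; rewrite find_iota0; reflexivity.
apply: (Cf_sum (F := fun i e => ~~ has (fun i => P i e) (iota 0 i.+1))) => //.
apply: Cp_neg; apply: (Cp_has (P := fun i e => P i (fun i => e i.+1))).
  by apply: Cf_S; cvar.
apply: (Cf_subst (Fs := fun i e => if i is 0 then e 0 else e i.+1) HP) => -[|i] lt_ik;
  exact: Cf_var.
Qed.

Lemma Cf_div k F G : Cf k F -> Cf k G -> Cf k (fun e => F e %/ G e).
Proof.
apply: Cf_app2.
(* The quotient is the number of positive multiples of the divisor up to the dividend; the test
   [0 < e 1] produces the value 0 of division by 0. *)
apply: (Cf_ext (F := fun e => \sum_(0 <= i < e 0) ((0 < e 1) && (i.+1 * e 1 <= e 0)))).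
  move=> e; have [->|d_gt0] := posnP (e 1).
    by rewrite divn0 big1 // => i _; rewrite ltnn.
  rewrite (eq_bigr (fun i => (i < e 0 %/ e 1) : nat)) => [|i _]; last by rewrite leq_divRL.
  elim: (e 0) (e 0 %/ e 1) (leq_div (e 0) (e 1)) => [|n IHn] m.
    by rewrite leqn0 => /eqP ->; rewrite big_geq.
  rewrite leq_eqVlt big_nat_recr //= => /orP[/eqP ->|].
    rewrite ltnSn addn1 -[in RHS](IHn n) //; congr _.+1.
    by apply: eq_big_nat => i /andP[_ lt_in]; rewrite lt_in ltnW.
  by rewrite ltnS => le_mn; rewrite IHn // ltnNge le_mn addn0.
apply: (Cf_sum (F := fun i e => (0 < e 1) && (i.+1 * e 1 <= e 0))); first cvar.
apply: Cp_and; apply: Cp_leq; first 1 [exact: Cf_const]; try cvar.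
by apply: Cf_mul; [apply: Cf_S|]; cvar.
Qed.

Lemma Cf_mod k F G : Cf k F -> Cf k G -> Cf k (fun e => F e %% G e).
Proof.
move=> HF HG; apply: (Cf_ext (F := fun e => F e - F e %/ G e * G e)).
  by move=> e; rewrite {1}(divn_eq (F e) (G e)) addKn.
by apply: Cf_sub => //; apply: Cf_mul => //; apply: Cf_div.
Qed.

(** A hook, redefined below as closure lemmas for further functions become available. *)
Ltac comp_user := fail.
Ltac comp1 := cbn beta zeta;
  first
  [ lazymatch goal with
    | |- Cf _ (fun e => e _) => apply: Cf_var; exact isT
    | |- Cf _ (fun=> ?n) => exact: Cf_const
    | |- Cp _ (fun=> ?n) => exact: Cp_const
    | |- Cf _ (fun e => nat_of_bool _) => apply: Cf_bool
    | |- Cf _ (fun e => S _) => apply: Cf_S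
    | |- Cf _ (fun e => predn _) => apply: Cf_pred
    | |- Cf _ (fun e => addn _ _) => apply: Cf_add
    | |- Cf _ (fun e => muln _ _) => apply: Cf_mul
    | |- Cf _ (fun e => subn _ _) => apply: Cf_sub
    | |- Cf _ (fun e => expn _ _) => apply: Cf_exp
    | |- Cf _ (fun e => divn _ _) => apply: Cf_div
    | |- Cf _ (fun e => modn _ _) => apply: Cf_mod
    | |- Cf _ (fun e => if _ then _ else _) => apply: Cf_if
    | |- Cp _ (fun e => if _ then _ else _) => apply: Cp_if
    | |- Cp _ (fun e => negb _) => apply: Cp_neg
    | |- Cp _ (fun e => andb _ _) => apply: Cp_and
    | |- Cp _ (fun e => orb _ _) => apply: Cp_or
    | |- Cp _ (fun e => leq _ _) => apply: Cp_leq
    | |- Cp _ (fun e => @eq_op _ _ _) => apply: Cp_eq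
    | |- Cf _ (fun e => bigop _ _ (fun i => BigBody i addn _ _)) => apply: Cf_sum
    | |- Cf _ (fun e => bigop _ _ (fun i => BigBody i muln _ _)) => apply: Cf_prod
    | |- Cp _ (fun e => has _ _) => apply: Cp_has
    | |- Cp _ (fun e => all _ _) => apply: Cp_all
    | |- Cf _ (fun e => find _ _) => apply: Cf_find
    | |- Cf _ (fun e => iter _ _ _) => apply: Cf_iter
    end
  | comp_user ].
Ltac comp := repeat comp1.

(** * Pairing, digits and course-of-values tables *)

Lemma double_cpair a b : (cpair a b).*2 = (a + b) * (a + b).+1 + b.*2.
Proof.
have : 2 %| (a + b) * (a + b).+1 by rewrite dvdn2 oddM /= andbN.
by move=> /divnK; rewrite /cpair; lia.
Qed.

Lemma cpair_inj a b a' b' : cpair a b = cpair a' b' -> a = a' /\ b = b'.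
Proof.
move=> E; have := double_cpair a b; have := double_cpair a' b'; rewrite E => E1 E2.
suff : a + b = a' + b' by nia.
case: (ltngtP (a + b) (a' + b')) => // h; nia.
Qed.

(** A code thus dominates its components, strictly so under a positive tag. This justifies the
    bounded searches and the order in which truth values are tabulated. *)
Lemma leq_cpair a b : a + b <= cpair a b.
Proof. have := double_cpair a b; nia. Qed.

Lemma find_iota_unique (P : pred nat) n a :
  a < n -> (forall i, P i = (i == a)) -> find P (iota 0 n) = a.
Proof.
move=> lt_an HP; rewrite (eq_find (a2 := pred1 a)) //.
have := @index_uniq _ 0 a (iota 0 n); rewrite size_iota nth_iota // add0n.
by apply=> //; apply: iota_uniq.
Qed.

Definition pfst z := find (fun a => has (fun b => cpair a b == z) (iota 0 z.+1)) (iota 0 z.+1).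
Definition psnd z := find (fun b => has (fun a => cpair a b == z) (iota 0 z.+1)) (iota 0 z.+1).

Lemma cpairK1 a b : pfst (cpair a b) = a.
Proof.
have le_ab := leq_cpair a b.
apply: find_iota_unique => [|i]; first by lia.
apply/hasP/eqP => [[j _ /eqP /cpair_inj []]|->] //.
by exists b => //; rewrite mem_iota; lia.
Qed.

Lemma cpairK2 a b : psnd (cpair a b) = b.
Proof.
have le_ab := leq_cpair a b.
apply: find_iota_unique => [|i]; first by lia.
apply/hasP/eqP => [[j _ /eqP /cpair_inj []]|->] //.
by exists a => //; rewrite mem_iota; lia.
Qed.

Lemma Cf_cpair k F G : Cf k F -> Cf k G -> Cf k (fun e => cpair (F e) (G e)).
Proof. by apply: Cf_app2; rewrite /cpair; comp. Qed.

Ltac comp_user ::= apply: Cf_cpair.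

Lemma Cf_pfst k F : Cf k F -> Cf k (fun e => pfst (F e)).
Proof. by apply: Cf_app1; rewrite /pfst; comp. Qed.

Lemma Cf_psnd k F : Cf k F -> Cf k (fun e => psnd (F e)).
Proof. by apply: Cf_app1; rewrite /psnd; comp. Qed.

Definition dig m H i := (H %/ m ^ i) %% m.

Lemma Cf_dig k F G H : Cf k F -> Cf k G -> Cf k H -> Cf k (fun e => dig (F e) (G e) (H e)).
Proof. by apply: Cf_app3; rewrite /dig; comp. Qed.

Ltac comp_user ::= first [apply: Cf_cpair | apply: Cf_pfst | apply: Cf_psnd | apply: Cf_dig].

Lemma dig_addl m H x n i : 0 < m -> i < n -> dig m (H + x * m ^ n) i = dig m H i.
Proof.
move=> m_gt0 lt_in; rewrite /dig -(subnKC lt_in) addSnnS expnD expnS.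
move: (m ^ (n - i.+1)) => y.
have -> : x * (m ^ i * (m * y)) = x * y * m * m ^ i by rewrite -!mulnA [y * _]mulnCA [in RHS]mulnC; nia.
by rewrite divnDMl ?expn_gt0 ?m_gt0 // addnC modnMDl.
Qed.

Lemma dig_top m H x n : H < m ^ n -> dig m (H + x * m ^ n) n = x %% m.
Proof.
move=> lt_H; have := leq_ltn_trans (leq0n _) lt_H => p_gt0.
by rewrite /dig addnC divnMDl // divn_small // addn0.
Qed.

Lemma dig_ex m n g : (forall i, i < n -> g i < m) ->
  exists2 H, H < m ^ n & forall i, i < n -> dig m H i = g i.
Proof.
elim: n => [|n IHn] lt_g; first by exists 0.
have [|H lt_H dH] := IHn; first by move=> i lt_in; apply/lt_g/ltnW.
have gn := lt_g n (leqnn _).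
exists (H + g n * m ^ n) => [|i].
  by rewrite expnS; nia.
rewrite ltnS leq_eqVlt => /orP[/eqP ->|lt_in]; first by rewrite dig_top // modn_small.
by rewrite dig_addl ?dH //; lia.
Qed.

(** Course-of-values recursion: step [i] may consult all earlier results, which are the digits of
    [T] below position [i]. *)
Definition tab (step : nat -> nat -> bool) n :=
  nat_rec (fun=> nat) 0 (fun i T => T + step T i * 2 ^ i) n.

Lemma tab_lt step n : tab step n < 2 ^ n.
Proof. by elim: n => //= n IHn; rewrite expnS; case: (step _ _) => /=; lia. Qed.

Lemma dig_tab step n i : i < n -> dig 2 (tab step n) i = step (tab step i) i.
Proof.
elim: n => // n IHn; rewrite ltnS leq_eqVlt => /orP[/eqP ->|lt_in] /=.
  by rewrite dig_top ?tab_lt // modn_small //; case: (step _ _).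
by rewrite dig_addl ?IHn.
Qed.

(** * Model checking a numerical encoding of a finite structure *)

Definition hd l := pfst l.-1.
Definition tl l := psnd l.-1.
Definition hasc (P : nat -> bool) l :=
  has (fun i => (iter i tl l != 0) && P (hd (iter i tl l))) (iota 0 l).
Definition allc (P : nat -> bool) l :=
  all (fun i => (iter i tl l == 0) || P (hd (iter i tl l))) (iota 0 l).

(* A structure on ['I_m] is given by two numbers [SU] and [SB] whose binary
   digits list its relations.  The digit of the table [T] with index
   [(c * m + a) * m + b] is the truth value of the formula with code [c] at
   [x = a], [y = b]; the table is computed digit by digit. *)
Definition ubit m SU A a := dig 2 SU (A * m + a) == 1.
Definition bbit m SB R a b := dig 2 SB ((R * m + a) * m + b) == 1.
Definition tbit m T c a b := dig 2 T ((c * m + a) * m + b) == 1.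
Definition sel (v a b : nat) := if v == 0 then a else b.

(** Positive and negative part of the integer with code [z]. Sums and comparisons stay in [nat] once
    the negative parts are moved to the other side. *)
Definition posc z := if z %% 2 == 0 then z %/ 2 else 0.
Definition negc z := if z %% 2 == 0 then 0 else (z %/ 2).+1.

Definition atomc m SU SB g a b :=
  if pfst g == 0 then ubit m SU (pfst (psnd g)) (sel (psnd (psnd g)) a b)
  else bbit m SB (pfst (psnd g)) (sel (pfst (psnd (psnd g))) a b)
                                 (sel (psnd (psnd (psnd g))) a b).

Definition rolec m SB R inv a b := if inv == 0 then bbit m SB R a b else bbit m SB R b a.

Definition countc m SB T R inv f v a b := \sum_(0 <= c < m)
  (rolec m SB R inv (sel v a b) c && tbit m T f (sel v a c) (sel v c b)).

Definition tlt l := psnd (psnd (psnd (psnd l.-1))).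

Definition psumc (part : nat -> nat) m SB T ts v a b := \sum_(0 <= i < ts)
  if iter i tlt ts == 0 then 0 else
  part (pfst (iter i tlt ts).-1) *
  countc m SB T (pfst (psnd (iter i tlt ts).-1))
    (pfst (psnd (psnd (iter i tlt ts).-1)))
    (pfst (psnd (psnd (psnd (iter i tlt ts).-1)))) v a b.

Definition cmpc c P Q :=
  if pfst c == 0 then P == Q else
  if pfst c == 1 then P != Q else
  if pfst c == 2 then P <= Q else
  if pfst c == 3 then Q <= P else
  if pfst c == 4 then P < Q else
  if pfst c == 5 then Q < P else
  if pfst c == 6 then P %% psnd c == Q %% psnd c else
  P %% psnd c != Q %% psnd c.

Definition exc m SU SB T r a b :=
  has (fun a' => has (fun b' =>
   [&& hasc (fun v => v == 0) (pfst r) || (a' == a),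
       hasc (fun v => v == 1) (pfst r) || (b' == b),
       atomc m SU SB (pfst (psnd r)) a' b' &
       tbit m T (psnd (psnd r)) a' b']) (iota 0 m)) (iota 0 m).

Definition cntc m SB T r a b :=
  cmpc (pfst (psnd (psnd r)))
    (psumc posc m SB T (pfst (psnd r)) (pfst r) a b + negc (psnd (psnd (psnd r))))
    (psumc negc m SB T (pfst (psnd r)) (pfst r) a b + posc (psnd (psnd (psnd r)))).

Definition formc m SU SB T c a b :=
  if pfst c == 0 then ubit m SU (pfst (psnd c)) (sel (psnd (psnd c)) a b) else
  if pfst c == 1 then bbit m SB (pfst (psnd c)) (sel (pfst (psnd (psnd c))) a b)
                        (sel (psnd (psnd (psnd c))) a b) else
  if pfst c == 2 then sel (pfst (psnd c)) a b == sel (psnd (psnd c)) a b else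
  if pfst c == 3 then ~~ tbit m T (psnd c) a b else
  if pfst c == 4 then tbit m T (pfst (psnd c)) a b && tbit m T (psnd (psnd c)) a b else
  if pfst c == 5 then exc m SU SB T (psnd c) a b else
  cntc m SB T (psnd c) a b.

Definition stepc m SU SB T i :=
  formc m SU SB T (i %/ (m * m)) ((i %/ m) %% m) (i %% m).

(** At a sentence the values of the variables are immaterial, hence the entry at 0, 0. The
    [c.+1 * (m * m)] digits cover all codes up to [c]. *)
Definition satc m SU SB c := tbit m (tab (stepc m SU SB) (c.+1 * (m * m))) c 0 0.

Definition qatomc m SU SB H x :=
  if pfst x == 0 then ubit m SU (pfst (psnd x)) (dig m H (psnd (psnd x)))
  else bbit m SB (pfst (psnd x)) (dig m H (pfst (psnd (psnd x))))
                                 (dig m H (psnd (psnd (psnd x)))).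

Definition cqc m SU SB N q :=
  has (fun H => allc (qatomc m SU SB H) q) (iota 0 (m ^ N)).

(** [F] bounds the size of the structure, which is [m.+1] as structures are nonempty; [N] bounds
    relation symbols and query variables, and hence the numbers of digits. *)
Definition counterc F N f q :=
  has (fun m => has (fun SU => has (fun SB =>
    satc m.+1 SU SB f && ~~ cqc m.+1 SU SB N q)
    (iota 0 (2 ^ (N * m.+1 * m.+1)))) (iota 0 (2 ^ (N * m.+1)))) (iota 0 F).

Lemma Cf_decide F : Cf 1 (fun e => F (e 0)) ->
  Cf 2 (fun e => ~~ counterc (F (e 0 + e 1).+1) (e 0 + e 1).+1 (e 0) (e 1)).
Proof.
move=> HF.
have Ctab k G N : Cf k N ->
    Cf k.+2 (fun e => nat_of_bool (G (e 1) (e 0) (fun i => e i.+2))) ->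
    Cf k (fun e => tab (fun T i => G T i e) (N e)).
  move=> HN HG; rewrite /tab.
  apply: (Cf_rec (G := fun i T e => T + G T i e * 2 ^ i)) => //; first exact: Cf_const.
  by apply: Cf_add; [comp | apply: Cf_mul => //; comp].
apply: Cf_bool; apply: Cp_neg.
rewrite /counterc /satc /cqc /allc /qatomc /stepc /formc /exc /cntc /cmpc /psumc /tlt
  /countc /rolec /atomc /posc /negc /sel /ubit /bbit /tbit /hasc /hd /tl.
repeat first [comp1 | apply: Ctab | apply: (Cf_app1 HF)].
Qed.

(* Correctness of the model checker *)
Scheme gpform_pterms_ind := Induction for gpform Sort Prop
  with pterms_gpform_ind := Induction for pterms Sort Prop.
Combined Scheme gpform_mutind from gpform_pterms_ind, pterms_gpform_ind.

Lemma size_enc_list s : size s <= enc_list s.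
Proof. elim: s => //= x s IHs; have := leq_cpair x (enc_list s); lia. Qed.

Lemma iter_fix0 T (f : T -> T) x n : f x = x -> iter n f x = x.
Proof. by move=> fx; elim: n => //= n ->. Qed.

Lemma iter_tl_cons x s i : iter i.+1 tl (enc_list (x :: s)) = iter i tl (enc_list s).
Proof. by rewrite iterSr /tl /= cpairK2. Qed.

Lemma has_enc_list P s n : size s <= n ->
  has (fun i => (iter i tl (enc_list s) != 0) && P (hd (iter i tl (enc_list s)))) (iota 0 n)
  = has P s.
Proof.
elim: s n => [|x s IHs] n.
  by move=> _; rewrite (@eq_has _ _ pred0) ?has_pred0 // => i; rewrite iter_fix0.
case: n => // n le_sn; rewrite [RHS]/= -(IHs n) //.
rewrite [iota 0 n.+1]/= -[1]addn0 iotaDl /= has_map; congr (_ || _).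
  by rewrite /hd /= cpairK1.
by apply: eq_has => i /=; rewrite -[tl (iter _ _ _)]iterS iter_tl_cons.
Qed.

Lemma hascP P s : hasc P (enc_list s) = has P s.
Proof. exact/has_enc_list/size_enc_list. Qed.

Lemma allcP P s : allc P (enc_list s) = all P s.
Proof.
rewrite -[RHS]negbK -has_predC -(has_enc_list (predC P) (size_enc_list s)).
rewrite -all_predC; apply: eq_all => i /=.
by rewrite negb_and !negbK.
Qed.

Import Order.TTheory GRing.Theory Num.Theory.

(* Otherwise [done] evaluates the encodings. *)
Opaque cpair pfst psnd dig tab ubit bbit.

Lemma enc_cq_lt N q a u : enc_cq q < N -> List.In a q -> u <= enc_cq_atom a -> u < N.
Proof.
move=> lt_N aq le_u; apply: leq_ltn_trans le_u (leq_trans _ lt_N).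
rewrite /enc_cq ltnS; elim: q aq {lt_N} => //= b q IHq.
have := leq_cpair (enc_cq_atom b) (enc_list [seq enc_cq_atom i | i <- q]).
move=> le_c [<-|/IHq le_a]; apply/leqW/(leq_trans _ le_c); first exact: leq_addr.
exact: leq_trans le_a (leq_addl _ _).
Qed.

Section ModelCheck.
Variables (n SU SB : nat).
Let m := n.+1.
Let U A (x : 'I_m) := ubit m SU A x.
Let B R (x y : 'I_m) := bbit m SB R x y.
Let T k := tab (stepc m SU SB) k.

Lemma tbit_tab k c (a b : 'I_m) : c.+1 * (m * m) <= k ->
  tbit m (T k) c a b = formc m SU SB (T ((c * m + a) * m + b)) c a b.
Proof.
move=> le_k; have lt_a := ltn_ord a; have lt_b := ltn_ord b.
have lt_i : (c * m + a) * m + b < c.+1 * (m * m) by nia.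
rewrite /tbit /T dig_tab ?(leq_trans lt_i) // {1}/stepc -/(T _).
have -> : ((c * m + a) * m + b) %/ (m * m) = c.
  by rewrite divnMA divnMDl // (divn_small lt_b) addn0 divnMDl // divn_small ?addn0.
by rewrite divnMDl // (divn_small lt_b) addn0 !modnMDl !modn_small // eqb1.
Qed.

Opaque tbit.

Lemma sel_var v (e : var -> 'I_m) : sel (enc_var v) (e false) (e true) = e v.
Proof. by case: v. Qed.

Lemma exvP (vs : seq var) (e : var -> 'I_m) (P : pred ('I_m * 'I_m)) :
  exv vs e (fun e' => P (e' false, e' true)) =
  [exists p : 'I_m * 'I_m, [&& (false \in vs) || (p.1 == e false),
                              (true \in vs) || (p.2 == e true) & P p]].
Proof.
elim: vs e => [|v vs IHvs] e /=.
  apply/idP/existsP => [Pe|[[a b] /and3P[/eqP /= -> /eqP -> ]]] //.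
  by exists (e false, e true); rewrite !eqxx.
apply/existsP/existsP => [[d]|[[a b] /and3P[/= Ha Hb Pab]]].
  rewrite IHvs => /existsP[[a b] /and3P[/= Ha Hb Pab]]; exists (a, b).
  rewrite Pab !inE /= andbT; case: v Ha Hb; rewrite /upd /= => Ha Hb; rewrite ?Ha ?Hb ?orbT //.
exists (if v then b else a); rewrite IHvs; apply/existsP; exists (a, b); rewrite Pab andbT /=.
by case: v Ha Hb; rewrite !inE /upd /= ?eqxx ?orbT => Ha Hb; rewrite ?Ha ?Hb.
Qed.

Lemma enc_intE z : (z = (posc (enc_int z))%:Z - (negc (enc_int z))%:Z)%R.
Proof.
rewrite /posc /negc; case: z => k /=; rewrite modn2 divn2 /= odd_double /=.
  by rewrite doubleK subr0.
by rewrite uphalf_double NegzE sub0r.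
Qed.

Lemma cmpcP c (P Q : nat) delta :
  cmpc (enc_cmp c) (P + negc (enc_int delta)) (Q + posc (enc_int delta)) =
  cmp_sat c (P%:Z - Q%:Z)%R delta.
Proof.
rewrite [in RHS](enc_intE delta).
move: (posc _) (negc _) => p q; rewrite /cmpc.
(* Adding [Q + q] to both sides turns the integer congruence into one between natural numbers. *)
have E d : ((P + q) %% d == (Q + p) %% d) =
    (P%:Z - Q%:Z == p%:Z - q%:Z %[mod d%:Z])%Z.
  rewrite -(eqz_modDr (Q%:Z + q%:Z)%R).
  have -> : (P%:Z - Q%:Z + (Q%:Z + q%:Z) = (P + q)%:Z)%R by lia.
  have -> : (p%:Z - q%:Z + (Q%:Z + q%:Z) = (Q + p)%:Z)%R by lia.
  by rewrite !modz_nat.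
by case: c => [||||||d|d]; rewrite /enc_cmp cpairK1 ?cpairK2 /= ?E //; lia.
Qed.


Lemma rolecP R inv (a b : 'I_m) : rolec m SB R (nat_of_bool inv) a b = role B R inv a b.
Proof. by case: inv. Qed.

Lemma atomcP g (e : var -> 'I_m) :
  atomc m SU SB (enc_atom g) (e false) (e true) = atom_sat U B e g.
Proof. by case: g => [A u|R u v]; rewrite /atomc /enc_atom !(cpairK1, cpairK2) /= !sel_var. Qed.

Lemma memcP v vs : hasc (fun w => w == enc_var v) (enc_list (map enc_var vs)) = (v \in vs).
Proof.
rewrite hascP has_map; elim: vs => //= w vs ->; rewrite inE; congr (_ || _).
by case: v w => [] [].
Qed.

(** A subformula has a smaller code, so its block of [m * m] digits is complete when a digit of the
    whole formula is computed. The sum over terms is stated for every bound [j] above the code,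
    since the tail of the list inherits its bound from the whole list. *)
Lemma tbit_sat :
  (forall g k (e : var -> 'I_m), (enc_form g).+1 * (m * m) <= k ->
     tbit m (T k) (enc_form g) (e false) (e true) = sat U B e g) /\
  (forall ts k (e : var -> 'I_m) v, enc_terms ts * (m * m) <= k ->
    forall j, enc_terms ts <= j ->
    let S part := \sum_(0 <= i < j)
      if iter i tlt (enc_terms ts) == 0 then 0 else
      part (pfst (iter i tlt (enc_terms ts)).-1) *
      countc m SB (T k) (pfst (psnd (iter i tlt (enc_terms ts)).-1))
        (pfst (psnd (psnd (iter i tlt (enc_terms ts)).-1)))
        (pfst (psnd (psnd (psnd (iter i tlt (enc_terms ts)).-1))))
        (enc_var v) (e false) (e true) in
    ((S posc)%:Z - (S negc)%:Z)%R = psum U B e v ts).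
Proof.
apply: gpform_mutind.
- move=> A u k e le_k; rewrite tbit_tab // /formc /= !(cpairK1, cpairK2) /=.
  by rewrite sel_var.
- move=> R u v k e le_k; rewrite tbit_tab // /formc /= !(cpairK1, cpairK2) /=.
  by rewrite !sel_var.
- move=> u v k e le_k; rewrite tbit_tab // /formc /= !(cpairK1, cpairK2) /=.
  by rewrite !sel_var.
- move=> f IHf k e le_k; rewrite tbit_tab // /formc /= !(cpairK1, cpairK2) /=.
  by rewrite IHf //; have := leq_cpair 3 (enc_form f); nia.
- move=> f IHf g IHg k e le_k; rewrite tbit_tab // /formc /= !(cpairK1, cpairK2) /=.
  have := leq_cpair 4 (cpair (enc_form f) (enc_form g)).
  have := leq_cpair (enc_form f) (enc_form g) => ? ?.
  by rewrite IHf ?IHg //; nia.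
- move=> vs a f IHf k e le_k; rewrite tbit_tab // /formc /= !(cpairK1, cpairK2) /=.
  rewrite /exc !(cpairK1, cpairK2).
  set j := (X in T X).
  have le_j : (enc_form f).+1 * (m * m) <= j.
    have := leq_cpair 5 (cpair (enc_list (map enc_var vs)) (cpair (enc_atom a) (enc_form f))).
    have := leq_cpair (enc_list (map enc_var vs)) (cpair (enc_atom a) (enc_form f)).
    have := leq_cpair (enc_atom a) (enc_form f).
    rewrite /j; nia.
  pose P (p : 'I_m * 'I_m) := atom_sat U B (fun v : var => if v then p.2 else p.1) a
    && sat U B (fun v : var => if v then p.2 else p.1) f.
  transitivity (exv vs e (fun e' => P (e' false, e' true))).
    rewrite exvP; apply/hasP/existsP => [[x]|[[x y] /and3P[Hx Hy /andP[Ha Hf]]]];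
      last rewrite /= in Hx Hy Ha Hf.
      rewrite mem_iota => /andP[_ lt_x] /hasP[y]; rewrite mem_iota => /andP[_ lt_y].
      case/and4P; rewrite (memcP false) (memcP true) => Hx Hy Ha Hf.
      exists (Ordinal lt_x, Ordinal lt_y); rewrite /P /=; set e' := fun v => _.
      apply/and3P; split=> //.
      by rewrite -(atomcP a e') Ha -(IHf j e').
    exists (x : nat); first by rewrite mem_iota ltn_ord.
    apply/hasP; exists (y : nat); first by rewrite mem_iota ltn_ord.
    rewrite (memcP false) (memcP true) Hx Hy /=.
    by move: Ha Hf; set e' := fun v => _; rewrite -(atomcP a e') -(IHf j e') // => -> ->.
  (* An assignment and the one rebuilt from its two values share their table entries, hence their
     truth values. *)
  have EP : forall e', P (e' false, e' true) = atom_sat U B e' a && sat U B e' f.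
    by move=> e'; rewrite /P -!(IHf j) // -!atomcP.
  by elim: vs e {le_k le_j j} => [|v vs IHvs] e /=; [|apply: eq_existsb => d].
- move=> v ts IHts c d k e le_k; rewrite tbit_tab // /formc /= !(cpairK1, cpairK2) /=.
  rewrite /cntc !(cpairK1, cpairK2).
  set j := (X in T X).
  have le_j : enc_terms ts * (m * m) <= j.
    have := leq_cpair 6 (cpair (enc_var v) (cpair (enc_terms ts) (cpair (enc_cmp c) (enc_int d)))).
    have := leq_cpair (enc_var v) (cpair (enc_terms ts) (cpair (enc_cmp c) (enc_int d))).
    have := leq_cpair (enc_terms ts) (cpair (enc_cmp c) (enc_int d)).
    rewrite /j; nia.
  by rewrite -(IHts j e v le_j _ (leqnn _)) -cmpcP.
- move=> k e v _ j _ /=.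
  rewrite !big1 // => i _; rewrite iter_fix0 //.
move=> lam R inv f IHf ts IHts k e v le_k [|j] // le_j S.
have le1 := leq_cpair (enc_int lam)
  (cpair R (cpair (nat_of_bool inv) (cpair (enc_form f) (enc_terms ts)))).
have le2 := leq_cpair R (cpair (nat_of_bool inv) (cpair (enc_form f) (enc_terms ts))).
have le3 := leq_cpair (nat_of_bool inv) (cpair (enc_form f) (enc_terms ts)).
have le4 := leq_cpair (enc_form f) (enc_terms ts).
have le_k' : enc_terms ts * (m * m) <= k by move: le_k => /=; nia.
have le_j' : enc_terms ts <= j by move: le_j => /=; lia.
have le_f : (enc_form f).+1 * (m * m) <= k by move: le_k => /=; nia.
rewrite [RHS]/= -(IHts k e v le_k' j le_j').
have E part : S part = part (enc_int lam) *
    #|[pred b : 'I_m | role B R inv (e v) b && sat U B (upd e (~~ v) b) f]| +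
    \sum_(0 <= i < j)
      if iter i tlt (enc_terms ts) == 0 then 0 else
      part (pfst (iter i tlt (enc_terms ts)).-1) *
      countc m SB (T k) (pfst (psnd (iter i tlt (enc_terms ts)).-1))
        (pfst (psnd (psnd (iter i tlt (enc_terms ts)).-1)))
        (pfst (psnd (psnd (psnd (iter i tlt (enc_terms ts)).-1))))
        (enc_var v) (e false) (e true).
  rewrite /S big_nat_recl //; congr (_ + _).
    rewrite /= !(cpairK1, cpairK2); congr (_ * _).
    rewrite /countc big_mkord -sum1_card [RHS]big_mkcond /=; apply: eq_bigr => c _.
    rewrite sel_var rolecP.
    have -> : sel (enc_var v) (e false) c = upd e (~~ v) c false by case: (v).
    have -> : sel (enc_var v) c (e true) = upd e (~~ v) c true by case: (v).
    by rewrite IHf // inE; case: (_ && _).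
  apply: eq_bigr => i _.
  have -> : iter i.+1 tlt (enc_terms (PCons lam R inv f ts)) = iter i tlt (enc_terms ts).
    by rewrite iterSr /tlt /= !cpairK2.
  by [].
rewrite !E [in RHS](enc_intE lam); lia.
Qed.

Lemma satcP f : satc m SU SB (enc_form f) = sat U B (fun=> ord0) f.
Proof.
rewrite -((proj1 tbit_sat) f ((enc_form f).+1 * (m * m)) (fun=> ord0)) //.
Qed.

Lemma qatomcP H a (h : nat -> 'I_m) :
  (forall u, u <= enc_cq_atom a -> h u = dig m H u :> nat) ->
  qatomc m SU SB H (enc_cq_atom a) = cq_atom_sat U B h a.
Proof.
case: a => [A u|R u v] /= hH; rewrite /qatomc !(cpairK1, cpairK2) /=.
  have := leq_cpair 0 (cpair A u); have := leq_cpair A u => ? ?.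
  by rewrite /U -hH //; lia.
have := leq_cpair 1 (cpair R (cpair u v)); have := leq_cpair R (cpair u v).
have := leq_cpair u v => ? ? ?.
by rewrite /B -!hH //; lia.
Qed.

Lemma all_In (V : Type) (P Q : pred V) s : (forall x, List.In x s -> P x = Q x) -> all P s = all Q s.
Proof. by elim: s => //= x s IHs PQ; rewrite PQ ?IHs; auto. Qed.

Lemma cqcP N q : enc_cq q < N -> cqc m SU SB N (enc_cq q) <-> cq_sat U B q.
Proof.
move=> lt_N; split.
  case/hasP=> H _; rewrite allcP all_map => Hq.
  exists (fun u => Ordinal (ltn_pmod (H %/ m ^ u) (ltn0Sn n))).
  by rewrite -(all_In (P := qatomc m SU SB H \o enc_cq_atom)) // => a _; apply: qatomcP.
case=> h Hh; have [|H lt_H dH] := @dig_ex m N (fun u => h u).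
  by move=> i _; apply: ltn_ord.
apply/hasP; exists H; first by rewrite mem_iota.
rewrite allcP all_map (all_In (Q := cq_atom_sat U B h)) // => a aq.
by apply: qatomcP => u le_u; rewrite dH //; apply: enc_cq_lt lt_N aq le_u.
Qed.

End ModelCheck.

Transparent cpair pfst psnd dig tab ubit bbit tbit.

(** * Invariance of satisfaction under assignments and isomorphisms *)

Lemma exvE (D : finType) (vs : seq var) (e : var -> D) (P : (var -> D) -> bool) :
  exv vs e P <-> exists2 e', (forall v, v \notin vs -> e' v = e v) & P e'.
Proof.
elim: vs e => [|v vs IHvs] e /=.
  split=> [|[e' Ee]]; first by exists e.
  by have -> : e' = e by apply: functional_extensionality => v; apply: Ee.
split=> [/existsP[d /IHvs[e' Ee Pe]]|[e' Ee Pe]].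
  exists e' => // w; rewrite inE negb_or => /andP[/negPf wv /Ee ->].
  by rewrite /upd wv.
apply/existsP; exists (e' v); apply/IHvs; exists e' => // w wvs.
by rewrite /upd; case: eqP => [->|/eqP wv] //; apply: Ee; rewrite inE negb_or wv.
Qed.

Section Structure.
Variables (D : finType) (U : nat -> pred D) (B : nat -> rel D).

Lemma sat_fv g (e1 e2 : var -> D) :
  (forall v, fv g v -> e1 v = e2 v) -> sat U B e1 g = sat U B e2 g.
Proof.
elim: g e1 e2 => [A u|R u v|u v|f IHf|f IHf g IHg|vs g f IHf|v ts c d] e1 e2 E /=.
- by rewrite E //= eqxx.
- by rewrite !E //= eqxx ?orbT.
- by rewrite !E //= eqxx ?orbT.
- by rewrite (IHf _ e2).
- by rewrite (IHf _ e2) ?(IHg _ e2) // => v fv_v; apply: E; rewrite /= fv_v ?orbT.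
- suff imp a b : (forall v, fv (FEx vs g f) v -> a v = b v) ->
      exv vs a (fun e' => atom_sat U B e' g && sat U B e' f) ->
      exv vs b (fun e' => atom_sat U B e' g && sat U B e' f).
    by apply/idP/idP; apply: imp => // v /E.
  move=> {}E /exvE[e' Ee /andP[Hg Hf]]; apply/exvE.
  exists (fun v => if v \in vs then e' v else b v) => [v /negPf -> //|].
  have E' v : atom_has g v || fv f v -> e' v = if v \in vs then e' v else b v.
    by move=> fv_v; case: ifPn => // vvs; rewrite Ee // E //= fv_v.
  apply/andP; split; last by rewrite -(IHf e') // => v fv_v; apply: E'; rewrite fv_v orbT.
  by case: g Hg E' {E} => [A u|R u w] /= Hg E'; rewrite -!E' ?eqxx ?orbT.
have {E}Ev : e1 v = e2 v by apply: E; rewrite /= eqxx.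
congr (cmp_sat _ _ _).
suff E b : upd e1 (~~ v) b = upd e2 (~~ v) b.
  by elim: ts => //= lam R inv f ts ->; rewrite Ev; congr (_ * _%:Z + _)%R;
    apply: eq_card => b; rewrite !inE E.
apply: functional_extensionality => w; rewrite /upd; case: eqP => // /eqP.
by case: v w Ev => [] [].
Qed.

End Structure.

Section Iso.
Variables (D D' : finType) (U : nat -> pred D) (B : nat -> rel D).
Variables (U' : nat -> pred D') (B' : nat -> rel D') (h : D -> D').
Hypothesis bij_h : bijective h.
Hypothesis hU : forall A x, U' A (h x) = U A x.
Hypothesis hB : forall R x y, B' R (h x) (h y) = B R x y.

Let updh e v x : upd (fun w => h (e w)) v (h x) = fun w => h (upd e v x w).
Proof. by apply: functional_extensionality => w; rewrite /upd; case: eqP. Qed.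

Lemma sat_iso :
  (forall g e, sat U' B' (fun v => h (e v)) g = sat U B e g) /\
  (forall ts e v, psum U' B' (fun v => h (e v)) v ts = psum U B e v ts).
Proof.
have inj_h := bij_inj bij_h; have [h' hK h'K] := bij_h.
apply: gpform_mutind => /=.
- by move=> A u e.
- by move=> R u v e.
- by move=> u v e; rewrite (inj_eq inj_h).
- by move=> f IHf e; rewrite IHf.
- by move=> f IHf g IHg e; rewrite IHf IHg.
- move=> vs g f IHf e; elim: vs e => [|v vs IHvs] e /=.
    by rewrite IHf; case: g => [A u|R u v] /=; rewrite ?hU ?hB.
  apply/existsP/existsP => [[x]|[x Hx]].
    by rewrite -[x]h'K updh IHvs; exists (h' x).
  by exists (h x); rewrite updh IHvs.
- by move=> v ts IHts c d e; rewrite IHts.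
- by [].
move=> lam R inv f IHf ts IHts e v; rewrite IHts; congr (_ * _%:Z + _)%R.
rewrite -(card_image inj_h); apply: eq_card => y; rewrite -[y]h'K mem_image // !inE.
by rewrite updh IHf /role; case: inv; rewrite hB.
Qed.

Lemma cq_sat_iso q : cq_sat U' B' q -> cq_sat U B q.
Proof.
have [h' hK h'K] := bij_h; case=> g Hg; exists (fun u => h' (g u)).
by apply: sub_all Hg => -[A u|R u v] /=; rewrite ?(=^~ hU, =^~ hB) !h'K.
Qed.
End Iso.

Lemma counterc_sound F N f q :
  enc_cq q < N -> gf2pres_sentence f -> counterc F N (enc_form f) (enc_cq q) ->
  ~ finite_entails f q.
Proof.
move=> lt_N /andP[_ /forallP clf] /hasP[m _ /hasP[SU _ /hasP[SB _ /andP[sf /negP nq]]]] ent.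
apply: nq; apply/cqcP => //; apply: ent; first by rewrite card_ord.
move=> e; rewrite satcP in sf; apply: etrans sf.
by apply: sat_fv => v; rewrite (negPf (clf v)).
Qed.

Lemma counterc_complete F N f q (D : finType) (U : nat -> pred D) (B : nat -> rel D) :
  enc_cq q < N -> 0 < #|D| <= F ->
  (forall A x, U A x -> A < N) -> (forall R x y, B R x y -> R < N) ->
  (forall e, sat U B e f) -> ~ cq_sat U B q ->
  counterc F N (enc_form f) (enc_cq q).
Proof.
move=> lt_N /andP[D_gt0 le_F] UN BN sf nq.
have [n En] : exists n, #|D| = n.+1 by case: #|D| D_gt0 => // n; exists n.
pose h (x : D) : 'I_n.+1 := cast_ord En (enum_rank x).
pose h' (x : 'I_n.+1) : D := enum_val (cast_ord (esym En) x).
have hK : cancel h h' by move=> x; rewrite /h /h' cast_ordK enum_rankK.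
have h'K : cancel h' h by move=> x; rewrite /h /h' enum_valK cast_ordKV.
have bij_h : bijective h by exists h'.
have [|SU lt_SU dSU] := @dig_ex 2 (N * n.+1) (fun i => U (i %/ n.+1) (h' (inord (i %% n.+1)))).
  by move=> i _; case: (U _ _).
have [|SB lt_SB dSB] := @dig_ex 2 (N * n.+1 * n.+1) (fun i => B (i %/ n.+1 %/ n.+1)
   (h' (inord (i %/ n.+1 %% n.+1))) (h' (inord (i %% n.+1)))).
  by move=> i _; case: (B _ _).
have hU A x : ubit n.+1 SU A (h x) = U A x.
  rewrite /ubit; case: (ltnP A N) => ltA.
    rewrite dSU; last by have := ltn_ord (h x); nia.
    rewrite divnMDl // modnMDl divn_small ?addn0 // modn_small // inord_val hK.
    by case: (U _ _).
  (* Symbols from [N] on are empty in [D], and digits beyond the chosen length are 0. *)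
  have -> : U A x = false by apply/negP => /UN; lia.
  rewrite /dig divn_small ?mod0n //; apply: leq_trans lt_SU _.
  by rewrite leq_exp2l //; nia.
have hB R x y : bbit n.+1 SB R (h x) (h y) = B R x y.
  rewrite /bbit; case: (ltnP R N) => ltR.
    rewrite dSB; last by have := ltn_ord (h x); have := ltn_ord (h y); nia.
    rewrite !divnMDl // !modnMDl (divn_small (ltn_ord (h y))) addn0 modnMDl divnMDl //.
    by rewrite divn_small ?addn0 // !modn_small // !inord_val !hK; case: (B _ _ _).
  have -> : B R x y = false by apply/negP => /BN; lia.
  rewrite /dig divn_small ?mod0n //; apply: leq_trans lt_SB _.
  by rewrite leq_exp2l //; nia.
apply/hasP; exists n; first by rewrite mem_iota; lia.
apply/hasP; exists SU; first by rewrite mem_iota.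
apply/hasP; exists SB; first by rewrite mem_iota.
rewrite satcP; apply/andP; split.
  have [/(_ f (fun=> h' ord0)) + _] := @sat_iso _ _ U B (fun A (x : 'I_n.+1) => ubit n.+1 SU A x)
    (fun R (x y : 'I_n.+1) => bbit n.+1 SB R x y) h bij_h hU hB.
  by rewrite h'K sf => ->.
by apply/negP => /(cqcP _ _ _ lt_N) /(@cq_sat_iso _ _ U B _ _ h bij_h hU hB).
Qed.

(** * Bounded generators of linear Diophantine systems *)

Lemma sum_count (T : finType) (s : seq T) (F : T -> nat) :
  \sum_(y <- s) F y = \sum_(y : T) count_mem y s * F y.
Proof.
elim: s => [|z s IHs]; first by rewrite big_nil big1.
rewrite big_cons IHs [RHS](eq_bigr (fun y => (z == y) * F y + count_mem y s * F y)); last first.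
  by move=> y _; rewrite /= mulnDl.
rewrite big_split /= [X in _ = X + _](bigD1 z) //= eqxx mul1n [X in _ = _ + X + _]big1 ?addn0 //.
by move=> y /negPf; rewrite eq_sym => ->.
Qed.

Section Single.
Variable V : finType.
Implicit Types (a : V -> int) (x y : {ffun V -> nat}).

Definition dotz a x : int := (\sum_v a v * (x v)%:Z)%R.

Lemma dotzB a x y : (forall v, y v <= x v) ->
  dotz a [ffun v => x v - y v] = (dotz a x - dotz a y)%R.
Proof.
move=> le_yx; rewrite /dotz -sumrB; apply: eq_bigr => v _.
by rewrite ffunE -mulrBr subzn.
Qed.

Lemma dotz_opp a x : dotz (fun v => - a v)%R x = (- dotz a x)%R.
Proof. by rewrite /dotz -sumrN; apply: eq_bigr => v _; rewrite mulNr. Qed.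

Definition delta_ffun v k : {ffun V -> nat} := [ffun w => if w == v then k else 0].

Lemma dotz_delta a v k : dotz a (delta_ffun v k) = (a v * k%:Z)%R.
Proof.
rewrite /dotz (bigD1 v) //= ffunE eqxx big1 ?addr0 // => w /negPf wv.
by rewrite ffunE wv mulr0.
Qed.

Lemma dotz_add a x y : dotz a [ffun v => x v + y v] = (dotz a x + dotz a y)%R.
Proof.
by rewrite /dotz -big_split /=; apply: eq_bigr => v _; rewrite ffunE PoszD mulrDr.
Qed.

(** When all negatively weighted coordinates are small, their total weight bounds the positive side
    of the equation, and with it [x v]. *)
Lemma dotz_large c a x v : (forall u, `|a u| <= c) -> dotz a x = 0%R ->
  (0 < a v)%R -> c <= x v ->
  (forall w, (a w < 0)%R -> (x w)%:Z < a v)%R -> x v <= #|V| * (c * c).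
Proof.
move=> le_a sol av_gt0 le_cx Hneg.
have : (a v * (x v)%:Z <= \sum_(u | u != v) (c * c)%:Z)%R.
  move: sol; rewrite /dotz (bigD1 v) //= => /eqP; rewrite addr_eq0 => /eqP ->.
  rewrite -sumrN; apply: ler_sum => u _.
  have := le_a u; have := le_a v; have := Hneg u.
  case: (ltP (a u) 0%R) => [au_lt0 /(_ isT)|au_ge0 _]; nia.
rewrite sumr_const -mulr_natr => le1.
have : #|[pred u | u != v]| <= #|V| by apply: max_card.
move: le1; set k := #|_| => le1 le2; nia.
Qed.

(** A small solution below [x] is a unit vector at a coordinate with coefficient 0, or two
    coordinates of opposite sign, each taken as often as the coefficient of the other says. If
    neither fits, a large coordinate forces those of opposite sign below [c], and [dotz_large]
    applies. The bound [c.+1] leaves room for the unit vector. *)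
Lemma dotz_reduce c a x : (forall u, `|a u| <= c) -> dotz a x = 0%R ->
  (forall v, x v <= #|V| * (c * c) + c) \/
  exists y, [/\ dotz a y = 0%R, forall v, y v <= c.+1, forall v, y v <= x v & exists v, 0 < y v].
Proof.
move=> le_a sol.
have [/existsP[v /andP[/eqP av0 xv]]|/existsPn nz] := boolP [exists v, (a v == 0%R) && (0 < x v)].
  right; exists (delta_ffun v 1); split; first by rewrite dotz_delta av0 mul0r.
  - by move=> w; rewrite ffunE; case: ifP.
  - by move=> w; rewrite ffunE; case: eqP => // ->.
  by exists v; rewrite ffunE eqxx.
have [/existsP[v /existsP[w /and4P[av aw le1 le2]]]|/existsPn nopair] :=
  boolP [exists v, [exists w, [&& (0 < a v)%R, (a w < 0)%R, `|a w| <= x v & `|a v| <= x w]]].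
  have vw : v != w by apply: contraTneq av => ->; rewrite -leNgt ltW.
  right; exists [ffun u => delta_ffun v `|a w| u + delta_ffun w `|a v| u]; split.
  - by rewrite dotz_add !dotz_delta; lia.
  - move=> u; rewrite !ffunE; have := le_a v; have := le_a w.
    by case: (u =P v) => [->|_]; rewrite ?(negPf vw) ?addn0; [lia | case: eqP => *; lia].
  - move=> u; rewrite !ffunE.
    case: (u =P v) => [->|_]; rewrite ?(negPf vw) ?addn0 ?add0n //.
    by case: eqP => [->|].
  by exists v; rewrite !ffunE eqxx; lia.
left=> v; rewrite leqNgt; apply/negP => lt_v.
have := nz v; have := le_a v => lav; case: (ltgtP (a v) 0%R) => [av _|av _|av]; last by lia.
  suff: x v <= #|V| * (c * c) by lia.
  apply: (@dotz_large c (fun v => - a v)%R x v) => [u||||w aw].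
  - by rewrite abszN.
  - by rewrite dotz_opp sol oppr0.
  - by lia.
  - by lia.
  have /existsPn/(_ v) := nopair w; have := le_a w; rewrite av; lia.
suff: x v <= #|V| * (c * c) by lia.
apply: (@dotz_large c a x v) => // [|w aw]; first by lia.
have /existsPn/(_ w) := nopair v; have := le_a w; rewrite av aw; lia.
Qed.

Lemma dotz_decompose c a x : (forall u, `|a u| <= c) -> dotz a x = 0%R ->
  exists2 ys : seq {ffun V -> nat},
    forall y, y \in ys -> dotz a y = 0%R /\ forall v, y v <= #|V| * (c * c) + c.+1 &
    forall v, x v = \sum_(y <- ys) y v.
Proof.
move=> le_a; have [k le_k] : exists k, \sum_v x v < k by exists (\sum_v x v).+1.
elim: k x le_k => // k IHk x le_k sol.
have [small|[y [sol_y le_y le_yx [v0 yv0]]]] := dotz_reduce le_a sol.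
  exists [:: x] => [y|v]; last by rewrite big_seq1.
  by rewrite inE => /eqP ->; split=> // v; rewrite addnS leqW.
have [||ys Hys Hsum] := IHk [ffun v => x v - y v].
- apply: leq_trans (_ : \sum_v x v <= k) => //; rewrite [X in X < _](bigD1 v0) //=.
  rewrite [X in _ < X](bigD1 v0) //= ffunE -addSn leq_add //.
    by have := le_yx v0; lia.
  by apply: leq_sum => v _; rewrite ffunE leq_subr.
- by rewrite dotzB // sol sol_y subrr.
exists (y :: ys) => [z|v].
  rewrite inE => /orP[/eqP ->|/Hys //]; split=> // v.
  by apply: leq_trans (le_y v) (leq_addl _ _).
by rewrite big_cons -Hsum ffunE subnKC.
Qed.

End Single.

Definition hbound N := N * (N * N) + N.+1.
(** One number above all that describes the system after one elimination: the summands bound the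
    number of new unknowns, their coefficients and the entries of the generators. *)
Definition hstep N := (hbound N).+1 ^ N + N * N * hbound N + hbound N.
(** The three factors bound the number of generators of the first equation, their multiplicities in
    a small solution of the others, and their entries. *)
Fixpoint hilb m N := if m is m'.+1 then hstep N * hilb m' (hstep N) * hstep N else 1.

Lemma dotz_comp (V W : finType) (g : W -> {ffun V -> nat}) (a : V -> int) (z : {ffun W -> nat}) :
  dotz a [ffun v => \sum_y z y * g y v] = dotz (fun y => dotz a (g y)) z.
Proof.
rewrite /dotz; transitivity (\sum_v \sum_y a v * (z y * g y v)%:Z)%R.
  apply: eq_bigr => v _; rewrite ffunE -mulr_sumr; congr (_ * _)%R.
  by elim/big_rec2: _ => // y p q _ <-; rewrite PoszD.
rewrite exchange_big /=; apply: eq_bigr => y _; rewrite mulr_suml.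
by apply: eq_bigr => v _; rewrite PoszM mulrCA mulrC -mulrA.
Qed.

Lemma sumn_bound (T : finType) (F : T -> nat) b : (forall y, F y <= b) -> \sum_y F y <= #|T| * b.
Proof. by move=> le_F; rewrite -sum_nat_const; apply: leq_sum. Qed.

Lemma dotz_bound (V : finType) (a : V -> int) (x : {ffun V -> nat}) N b :
  (forall v, `|a v| <= N) -> (forall v, x v <= b) -> `|dotz a x| <= #|V| * (N * b).
Proof.
move=> le_a le_x; apply: leq_trans (_ : \sum_v `|a v| * x v <= _).
  rewrite /dotz -lez_nat abszE; apply: le_trans (ler_norm_sum _ _ _) _.
  have -> : (Posz (\sum_v `|a v| * x v) = \sum_v `|a v * (x v)%:Z|)%R.
    by elim/big_rec2: _ => // v p q _ <-; rewrite PoszD normrM; congr (_ + _)%R; lia.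
  exact: lexx.
by apply: sumn_bound => v; apply: leq_mul.
Qed.

(* The solutions of the first equation are generated by finitely many bounded
   ones; using their multiplicities as new unknowns eliminates that equation. *)
Theorem hilbert_basis_bound N (V : finType) (A : seq (V -> int)) (x : {ffun V -> nat}) :
  #|V| <= N -> (forall a v, List.In a A -> `|a v| <= N) ->
  (forall a, List.In a A -> dotz a x = 0%R) ->
  exists2 ys : seq {ffun V -> nat},
    forall y, y \in ys ->
      (forall a, List.In a A -> dotz a y = 0%R) /\ forall v, y v <= hilb (size A) N &
    forall v, x v = \sum_(y <- ys) y v.
Proof.
move Ek: (size A) => k; elim: k N V A x Ek => [|k IHk] N V [|a A] x //= Ek le_V le_A sol.
  have [||ys Hys Hsum] := @dotz_decompose V 0 (fun=> 0%R) x => //.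
    by rewrite /dotz big1 // => v _; rewrite mul0r.
  exists ys => // y /Hys[_ le_y]; split=> // v.
  by have := le_y v; rewrite !muln0.
have [||ys Hys Hsum] := @dotz_decompose V N a x.
- by move=> v; apply: le_A; left.
- by apply: sol; left.
have {}Hys y : y \in ys -> dotz a y = 0%R /\ forall v, y v <= hbound N.
  case/Hys=> -> le_y; split=> // v; apply: leq_trans (le_y v) _.
  by rewrite /hbound leq_add // ?leq_mul.
pose tn (y : {ffun V -> 'I_(hbound N).+1}) : {ffun V -> nat} := [ffun v => y v : nat].
pose W : finType := {y : {ffun V -> 'I_(hbound N).+1} | dotz a (tn y) == 0%R}.
pose g (y : W) := tn (val y).
have [ws Ews] : exists ws, ys = map g ws.
  elim: ys Hys {Hsum} => [|y ys IHys] Hys; first by exists [::].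
  have [|ws ->] := IHys; first by move=> z zys; apply: Hys; rewrite inE zys orbT.
  have [sol_y le_y] := Hys y (mem_head _ _).
  have Ey : tn [ffun v => inord (y v)] = y.
    by apply/ffunP => v; rewrite !ffunE inordK // ltnS.
  have Wy : dotz a (tn [ffun v => inord (y v)]) == 0%R by rewrite Ey sol_y.
  by exists (exist (fun y => is_true (dotz a (tn y) == 0%R)) _ Wy :: ws); congr (_ :: _); apply: esym.
have le_g y v : g y v <= hbound N by rewrite ffunE -ltnS.
pose z : {ffun W -> nat} := [ffun y => count_mem y ws].
have Ez : x = [ffun v => \sum_y z y * g y v].
  apply/ffunP => v; rewrite ffunE Hsum Ews big_map sum_count.
  by apply: eq_bigr => y _; rewrite [z y]ffunE.
(* The remaining equations, rewritten for the multiplicities by means of [dotz_comp]. *)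
pose A' := [seq (fun y : W => dotz b (g y)) | b <- A].
have inA' c : List.In c A' -> exists2 b, List.In b A & c = fun y => dotz b (g y).
  by case/List.in_map_iff=> b [<- bA]; exists b.
have [||c v /inA'[b bA ->]|c /inA'[b bA ->]|zs Hzs Hsumz] := IHk (hstep N) W A' z.
- by rewrite size_map; case: Ek.
- apply: leq_trans (_ : (hbound N).+1 ^ N <= _); last by rewrite /hstep -addnA leq_addr.
  apply: leq_trans (_ : (hbound N).+1 ^ #|V| <= _); last by rewrite leq_pexp2l.
  by rewrite card_sig (leq_trans (max_card _)) // card_ffun card_ord.
- apply: leq_trans (dotz_bound (N := N) _ (le_g v)) _.
    by move=> w; apply: le_A; right.
  apply: leq_trans (_ : N * N * hbound N <= _); first by rewrite mulnA !leq_mul.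
  by rewrite /hstep; lia.
- by rewrite -dotz_comp -Ez; apply: sol; right.
exists [seq [ffun v => \sum_y y' y * g y v] | y' : {ffun W -> nat} <- zs].
  move=> _ /mapP[y' /Hzs[sol_y' le_y'] ->]; split=> [b|v].
    rewrite dotz_comp; case=> [<-|bA].
      rewrite /dotz big1 // => y _; have /eqP := valP y; rewrite -/(g y) /dotz => ->.
      by rewrite mul0r.
    by apply: sol_y'; apply/List.in_map_iff; exists b.
  rewrite ffunE.
  apply: leq_trans (sumn_bound (b := hilb k (hstep N) * hbound N) _) _.
    by move=> y; apply: leq_mul.
  rewrite /= -mulnA leq_mul //; last by rewrite leq_mul // /hstep leq_addl.
  apply: leq_trans (_ : (hbound N).+1 ^ N <= _); last by rewrite /hstep -addnA leq_addr.
  apply: leq_trans (_ : (hbound N).+1 ^ #|V| <= _); last by rewrite leq_pexp2l.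
  by rewrite card_sig (leq_trans (max_card _)) // card_ffun card_ord.
move=> v; rewrite Ez ffunE big_map.
transitivity (\sum_(y' <- zs) \sum_y y' y * g y v).
  rewrite exchange_big /=; apply: eq_bigr => y _.
  by rewrite Hsumz big_distrl.
by apply: eq_bigr => y' _; rewrite ffunE.
Qed.

(** * Covers of large girth with prescribed degrees *)

(** Fibres of equal size are matched by position in their enumerations. *)
Lemma class_perm (H X : finType) (f g : H -> X) :
  (forall x, #|[pred h | f h == x]| = #|[pred h | g h == x]|) ->
  exists s : {perm H}, forall h, f (s h) = g h.
Proof.
move=> Ecard.
pose F x := enum [pred h | f h == x]; pose G x := enum [pred h | g h == x].
pose s h := nth h (F (g h)) (index h (G (g h))).
have lt_i h : index h (G (g h)) < size (F (g h)).
  by rewrite -cardE Ecard cardE index_mem mem_enum inE.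
have fs h : f (s h) = g h.
  by have := mem_nth h (lt_i h); rewrite mem_enum inE => /eqP.
have inj_s : injective s.
  move=> h h' E; have Eg : g h = g h' by rewrite -fs E fs.
  move: E; rewrite /s (set_nth_default h) -?Eg; last by rewrite Eg.
  move/eqP; rewrite nth_uniq ?lt_i ?enum_uniq //; last by rewrite Eg.
  by apply: contraTeq => ne; apply: contraNneq ne => E; rewrite -(@nth_index _ h h (G (g h))) ?E ?nth_index // mem_enum inE ?Eg.
by exists (perm inj_s) => h; rewrite permE.
Qed.

Lemma card_permT (T : finType) : #|{: {perm T}}| = #|T|`!.
Proof.
rewrite -[#|T|]cardsT -card_perm; apply: eq_card => s.
by rewrite !inE; apply/esym/subsetP => t; rewrite inE.
Qed.

Lemma card_bseq (T : finType) n : #|{: n.-bseq T}| <= #|T|.+1 ^ n.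
Proof.
pose f (t : n.-bseq T) : {ffun 'I_n -> option T} := [ffun i : 'I_n => onth t i].
have inj_f : injective f.
  move=> s t /ffunP E; apply: val_inj; apply: eq_from_onth => i /=.
  have [lt_i|le_i] := ltnP i n; first by have := E (Ordinal lt_i); rewrite !ffunE.
  by rewrite !onth_default // (leq_trans (size_bseq _)).
by apply: leq_trans (leq_card _ inj_f) _; rewrite card_ffun card_option card_ord.
Qed.

Section Involutions.
Variables (H : finType) (n : nat).
Let T := n.-bseq H.

(* The move along the edge coloured [e] in the tree of words of length at most
   [n] without equal consecutive letters. *)
Definition flip (e : H) (s : seq H) : seq H :=
  if ohead s == Some e then (if ohead (behead s) == Some e then s else behead s)
  else if size s < n then e :: s else s.

Lemma size_flip e s : size s <= n -> size (flip e s) <= n.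
Proof.
move=> le_s; rewrite /flip; do !case: ifP => // _.
by rewrite size_behead (leq_trans (leq_pred _)).
Qed.

Lemma flipK e s : size s <= n -> flip e (flip e s) = s.
Proof.
move=> le_s; rewrite {2}/flip; case: ifP => [/eqP h1|h1].
  case: ifP => h2; first by rewrite /flip h1 eqxx h2.
  case: s le_s h1 h2 => [|x s] //= le_s [->] h2.
  by rewrite /flip h2 le_s.
case: ifP => h2; first by rewrite /flip /= eqxx h1.
by rewrite /flip h1 h2.
Qed.

Definition flipb e (t : T) : T := Bseq (size_flip e (size_bseq t)).

Lemma flipbK e : involutive (flipb e).
Proof. by move=> t; apply: val_inj; rewrite /= flipK ?size_bseq. Qed.

Definition gen e : {perm T} := perm (can_inj (flipbK e)).

Lemma genK e : (gen e * gen e = 1)%g.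
Proof. by apply/permP => t; rewrite permM !permE /= flipbK. Qed.

(** Applied to the empty word, the product writes its letters one after another: unequal neighbours
    prevent deletions and [k <= n] leaves room. *)
Lemma gen_word (e : nat -> H) k : k <= n -> (forall i, i.+1 < k -> e i != e i.+1) ->
  val ((\prod_(i < k) gen (e i))%g ([bseq] : T)) = rev [seq e i | i <- iota 0 k].
Proof.
elim: k => [|k IHk] le_k ne; first by rewrite big_ord0 perm1.
rewrite big_ord_recr /= permM permE /= IHk ?(ltnW le_k) //; last by move=> i /ltnW; apply: ne.
rewrite -[iota 1 k]/(behead (iota 0 k.+1)) -[e 0 :: _]/(map e (iota 0 k.+1)).
rewrite -addn1 iotaD map_cat rev_cat /= /flip size_rev size_map size_iota le_k.
case: k ne {IHk le_k} => [|k] ne //.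
rewrite -addn1 iotaD map_cat rev_cat /= add0n.
by have /negPf := ne k (leqnn _); rewrite addn1 -(inj_eq (@Some_inj _)) => ->.
Qed.

Lemma gen_word_neq1 (e : nat -> H) k : 0 < k <= n -> (forall i, i.+1 < k -> e i != e i.+1) ->
  (\prod_(i < k) gen (e i) != 1)%g.
Proof.
move=> /andP[k_gt0 le_k] ne; apply/eqP => E; have := gen_word le_k ne.
by rewrite E perm1 /=; case: k k_gt0 {le_k ne E} => // k _ /(congr1 size); rewrite size_rev.
Qed.

Lemma gen_inj : 0 < n -> injective gen.
Proof.
move=> n_gt0 x y /permP/(_ ([bseq] : T)); rewrite !permE => /(congr1 val).
by rewrite /= /flip /= n_gt0 => -[].
Qed.
End Involutions.

Section Cover.
Variables (A P L : finType) (cl : A -> P) (inv : L -> L) (l0 : L).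
Variables (w : A -> L -> P -> nat) (n W : nat).
Hypotheses (invK : involutive inv) (inv0 : inv l0 = l0).
Hypothesis wW : forall a l c, w a l c <= W.
Hypothesis balanced : forall c l c',
  \sum_(a | cl a == c) w a l c' = \sum_(a | cl a == c') w a (inv l) c.
Hypothesis n_gt0 : 0 < n.

(** Half-edges: an origin, a label, a target class, and an index that tells parallel ones apart.
    Those with index below the prescribed number are [valid]. *)
Let H : finType := (A * L * P * 'I_W)%type.
Implicit Types h : H.
Let hA h := h.1.1.1.
Let hL h := h.1.1.2.
Let hP h := h.1.2.
Let valid h := h.2 < w (hA h) (hL h) (hP h).

Let count_valid a l c :
  #|[pred h | [&& valid h, hA h == a, hL h == l & hP h == c]]| = w a l c.
Proof.
rewrite -sum1_card.
transitivity (\sum_(i < W | i < w a l c) 1).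
  rewrite (reindex_onto (fun i : 'I_W => ((a, l, c, i) : H)) (fun h => h.2)) /=.
    by apply: eq_bigl => i; rewrite inE /valid /hA /hL /hP /= !eqxx !andbT.
  by case=> [[[a' l'] c'] i] /=; rewrite !inE /= => /and4P[_ /eqP <- /eqP <- /eqP <-].
rewrite -(big_ord_widen_cond W predT (fun=> 1) (wW a l c)).
by rewrite sum1_card card_ord.
Qed.

Let count_class c l c' :
  #|[pred h | [&& valid h, cl (hA h) == c, hL h == l & hP h == c']]| =
  \sum_(a | cl a == c) w a l c'.
Proof.
rewrite -sum1_card (partition_big hA (fun a => cl a == c)) /=; last first.
  by move=> h; rewrite inE => /and4P[].
apply: eq_bigr => a /eqP cla; rewrite -count_valid -sum1_card.
apply: eq_bigl => h; rewrite !inE -!andbA; case: (hA h =P a) => [->|_].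
  by rewrite cla eqxx !andbT.
by rewrite !andbF.
Qed.

(** By [balanced], there are as many half-edges with label [l] from one class to another as there
    are with label [inv l] back, so [class_perm] matches them. The match is not claimed to be an
    involution. *)
Let cover_perm : exists s : {perm H}, forall h,
  valid (s h) = valid h /\
  (valid h -> [/\ cl (hA (s h)) = hP h, hL (s h) = inv (hL h) & hP (s h) = cl (hA h)]).
Proof.
pose f h := if valid h then Some (cl (hA h), hL h, hP h) else None.
pose g h := if valid h then Some (hP h, inv (hL h), cl (hA h)) else None.
have [|s Es] := @class_perm H _ f g.
  case=> [[[c l] c']|]; last first.
    by apply: eq_card => h; rewrite !inE /f /g; case: (valid h).
  transitivity (\sum_(a | cl a == c) w a l c').
    rewrite -count_class; apply: eq_card => h; rewrite !inE /f.
    by case: (valid h); rewrite //= -[Some _ == _]/((_, _, _) == _) !xpair_eqE -andbA.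
  rewrite balanced -count_class; apply: eq_card => h; rewrite !inE /g.
  case: (valid h); rewrite //= -[Some _ == _]/((_, _, _) == _) !xpair_eqE.
  by rewrite (inv_eq invK) [RHS]andbC; congr (_ && _); apply: andbC.
exists s => h; have := Es h; rewrite /f /g.
by case: (valid h); case: (valid (s h)) => // -[-> -> ->].
Qed.

Theorem cover_exists : exists (D : finType) (p : D -> A) (lab : D -> D -> L),
  [/\ #|D| = #|A| * 2 * (#|{: n.-bseq H}|)`!,
      (forall a, exists s, p s = a),
      (forall s t, lab t s = inv (lab s t)) /\ (forall s, lab s s = l0),
      (forall s l c, l != l0 -> #|[pred t | (lab s t == l) && (cl (p t) == c)]| = w (p s) l c) &
      (forall k (s : nat -> D), 0 < k <= n ->
         (forall i, i < k -> lab (s i) (s i.+1) != l0) ->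
         (forall i, i.+2 <= k -> s i != s i.+2) -> s k != s 0)].
Proof.
have [sg Hsg] := cover_perm.
pose G := {perm n.-bseq H}; pose D : finType := (A * bool * G)%type.
(* Bipartite doubling: the edge coloured [e] joins the origin of [e] on sheet [false] to the origin
   of [sg e] on sheet [true]. This avoids loops and makes a mere permutation [sg] sufficient. As
   [gen e] is an involution, the same colour leads back. *)
pose inc (s : D) e := valid e && ((if s.1.2 then hA (sg e) else hA e) == s.1.1).
pose nbr (s : D) e : D :=
  (if s.1.2 then hA e else hA (sg e), ~~ s.1.2, s.2 * gen n e)%g.
pose elab (s : D) e := if s.1.2 then inv (hL e) else hL e.
pose lab s t := if [pick e | inc s e && (nbr s e == t)] is Some e then elab s e else l0.
(* Different colours lead to different neighbours, so the cover has no parallel edges and [lab] is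
   well defined. *)
have nbr_inj s : injective (nbr s) by move=> e e' [_ /mulgI /(gen_inj n_gt0)].
have nbrK s e : inc s e -> nbr (nbr s e) e = s.
  case: s => [[a b] x] /andP[_ /eqP /= <-]; rewrite /nbr /= negbK -mulgA genK mulg1.
  by case: b.
have inc_nbr s e : inc s e -> inc (nbr s e) e.
  by case: s => [[a b] x] /andP[ve _]; rewrite /inc ve /=; case: b => /=.
have labE s e : inc s e -> lab s (nbr s e) = elab s e.
  rewrite /lab => se; case: pickP => [e' /andP[_ /eqP /nbr_inj ->] //|/(_ e)].
  by rewrite se eqxx.
have labP s t : lab s t != l0 -> exists2 e, inc s e & t = nbr s e.
  rewrite /lab; case: pickP => [e /andP[se /eqP <-] _|_]; last by rewrite eqxx.
  by exists e.
have elab_nbr s e : elab (nbr s e) e = inv (elab s e).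
  by rewrite /elab /=; case: s.1.2; rewrite ?invK.
have labC s t : lab t s = inv (lab s t).
  have imp x y : lab x y != l0 -> lab y x = inv (lab x y).
    move=> /labP[e xe ->]; rewrite labE //.
    by have := labE _ _ (inc_nbr _ _ xe); rewrite nbrK // => ->.
  have [/eqP st|/imp //] := boolP (lab s t == l0).
  have [/eqP ts|/imp E] := boolP (lab t s == l0); first by rewrite st ts.
  by rewrite E invK.
exists D, (fun s => s.1.1), lab; split=> //.
- by rewrite !card_prod card_bool card_permT.
- by move=> a; exists (a, true, 1%g).
- split=> // s; apply/eqP/negPn/negP => /labP[e _ /(congr1 (fun x => x.1.2))] /=.
  by case: s.1.2.
- move=> s l c l_neq0.
  transitivity #|[pred e | [&& inc s e, elab s e == l & cl (nbr s e).1.1 == c]]|.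
    rewrite -(card_image (nbr_inj s)); apply: eq_card => t; rewrite inE.
    apply/andP/imageP => [[/eqP lt ct]|[e]].
      have [|e se Et] := labP s t; first by rewrite lt.
      by exists e => //; rewrite inE se -labE // -Et lt eqxx.
    by rewrite inE => /and3P[se le ce] ->; rewrite labE.
  rewrite -count_valid; case: s => [[a b] x]; case: b.
    (* On sheet [true], counting by [sg e] in place of [e] turns the inverted label and the
       exchanged classes into those prescribed at [a]. *)
    rewrite -!sum1_card [RHS](reindex_inj (@perm_inj _ sg)) /=.
    apply: eq_bigl => e; rewrite !inE /inc /elab /=; have [-> +] := Hsg e.
    by case: (valid e) => //= /(_ isT)[_ -> ->].
  apply: eq_card => e; rewrite !inE /inc /elab /=.
  by case: (boolP (valid e)) => //= ve; have [_ /(_ ve)[-> _ _]] := Hsg e.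
move=> k s /andP[k_gt0 le_k] adj nb; apply/eqP => Esk.
have /fin_all_exists[e He] : forall i : 'I_k, exists e, inc (s i) e /\ s i.+1 = nbr (s i) e.
  by move=> i; have [e] := labP _ _ (adj i (ltn_ord i)); exists e.
case: k => // k in k_gt0 le_k adj nb Esk e He *.
pose e' i := e (inord i).
have He' i : i <= k -> inc (s i) (e' i) /\ s i.+1 = nbr (s i) (e' i).
  by move=> le_i; have := He (inord i); rewrite inordK.
(* The group component accumulates the colours of the walk. A closed walk makes their product
   trivial, so by [gen_word_neq1] two consecutive colours agree, which means that the walk turns
   back. *)
have /(_ k.+1 (leqnn _)) : forall j, j <= k.+1 -> (s j).2 = ((s 0).2 * \prod_(i < j) gen n (e' i))%g.
  elim=> [|j IHj] le_j; first by rewrite big_ord0 mulg1.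
  by rewrite big_ord_recr mulgA -IHj ?(ltnW le_j) //; have [_ ->] := He' j le_j.
rewrite Esk -[LHS]mulg1 => /mulgI /esym /eqP; apply/negP.
apply: gen_word_neq1; first by rewrite le_k.
move=> i lt_i; have [i1 Ei1] := He' i (ltnW lt_i); have [_ Ei2] := He' i.+1 lt_i.
apply: contraNneq (nb i lt_i) => Ee.
by rewrite Ei2 -Ee Ei1 nbrK.
Qed.
End Cover.

(** * Bounded degree vectors *)

Definition cmp_modulus (c : cmp) := match c with CCong d | CNCong d => d | _ => 0 end.

(* A linear equation with two natural slacks that holds at [s] and forces [Q];
   it replaces comparisons and congruences by equations. *)
Definition row_forces C (s : int) (Q : int -> Prop) :=
  exists r al al' : int, exists u u' : nat,
  [/\ `|r| <= C.+1, `|al| <= C.+1, `|al'| <= C.+1,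
      (s - r + al * u%:Z + al' * u'%:Z = 0)%R &
      forall (s' : int) (v v' : nat), (s' - r + al * v%:Z + al' * v'%:Z = 0)%R -> Q s'].

Lemma row_forces_sub C s (Q Q' : int -> Prop) :
  (forall s', Q s' -> Q' s') -> row_forces C s Q -> row_forces C s Q'.
Proof.
move=> sub [r [al [al' [u [u' [Hr Ha Ha' Hs Hall]]]]]].
by exists r, al, al', u, u'; split=> // s' v v' /Hall /sub.
Qed.

(** One slack of fixed sign, starting at distance 1 from [delta], keeps [s] on its side; order
    comparisons depend on nothing else. *)
Lemma sign_row (delta s : int) C : `|delta| <= C ->
  row_forces C s (fun s' => (s' == delta) = (s == delta) /\ (s' < delta)%R = (s < delta)%R).
Proof.
move=> le_C; rewrite /row_forces; case: (ltgtP s delta) => [lt|gt|->].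
- exists (delta - 1)%R, 1%R, 0%R, `|(delta - 1 - s)%R|, 0.
  by split; try lia; move=> s' v v' E; split; lia.
- exists (delta + 1)%R, (-1)%R, 0%R, `|(s - delta - 1)%R|, 0.
  by split; try lia; move=> s' v v' E; split; lia.
exists delta, 0%R, 0%R, 0, 0.
by split; try lia; move=> s' v v' E; split; lia.
Qed.

(** The slacks have opposite signs, so their difference reaches every multiple of [d] while both
    stay natural. *)
Lemma cong_row d (s : int) C : d <= C -> 0 < d ->
  row_forces C s (fun s' => (s' == s %[mod d%:Z])%Z).
Proof.
move=> le_d d_gt0; exists (s %% d%:Z)%Z, (Posz d), (- d%:Z)%R.
exists (if (s %/ d%:Z)%Z is Negz n then n.+1 else 0), (if (s %/ d%:Z)%Z is Posz n then n else 0).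
have d0 : Posz d != 0%R by lia.
have r0 := modz_ge0 s d0; have r1 := ltz_mod s d0.
split; try by lia.
  by rewrite {1}(divz_eq s d%:Z); case: (s %/ d%:Z)%Z => n; rewrite ?NegzE; lia.
move=> s' v v' E.
have -> : (s' = (v'%:Z - v%:Z) * d%:Z + (s %% d%:Z)%Z)%R by lia.
by rewrite modzMDl modz_mod.
Qed.

Lemma cmp_row (c : cmp) (delta s : int) C : `|delta| <= C -> cmp_modulus c <= C ->
  row_forces C s (fun s' => cmp_sat c s' delta = cmp_sat c s delta).
Proof.
move=> le_delta; have := sign_row s le_delta => sign.
(* Congruence modulo 0 is equality and falls under [sign]. *)
case: c => [||||||[|d]|[|d]] /= le_d;
  try (apply: row_forces_sub sign => s' []; lia).
- by apply: row_forces_sub (cong_row s le_d _) => // s' /eqP ->.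
- by apply: row_forces_sub (cong_row s le_d _) => // s' /eqP ->.
Qed.

(** For each coordinate in the support one summand that is positive there is kept; at most [#|T|]
    bounded summands remain and the support does not change. *)
Lemma sum_bound_supp (T : finType) (b : nat) (zs : seq {ffun T -> nat}) (P : {ffun T -> nat} -> Prop) :
  P [ffun=> 0] -> (forall y z : {ffun T -> nat}, P y -> P z -> P [ffun v => y v + z v]) ->
  (forall z, z \in zs -> P z /\ forall v, z v <= b) ->
  exists x' : {ffun T -> nat}, [/\ P x', forall v, x' v <= #|T| * b &
    forall v, (0 < x' v) = (0 < \sum_(z <- zs) z v)].
Proof.
move=> P0 PD Hzs.
have pos v : (0 < \sum_(z <- zs) z v) = has (fun z : {ffun T -> nat} => 0 < z v) zs.
  by elim: zs {Hzs} => [|z zs IH]; rewrite ?big_nil // big_cons addn_gt0 IH.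
have /fin_all_exists[f Hf] : forall v : T, exists z : {ffun T -> nat},
    [/\ P z, forall u, z u <= b, (0 < \sum_(z <- zs) z v -> 0 < z v) &
        forall u, 0 < z u -> 0 < \sum_(z <- zs) z u].
  move=> v; case: (posnP (\sum_(z <- zs) z v)) => [_|].
    by exists [ffun=> 0]; split=> // u; rewrite ffunE.
  rewrite pos => /hasP[z zzs zv]; have [Pz le_z] := Hzs _ zzs; exists z; split=> // u zu.
  by rewrite pos; apply/hasP; exists z.
exists [ffun u => \sum_v f v u]; split.
- have Ps s : P [ffun u => \sum_(v <- s) f v u].
    elim: s => [|v s IHs].
      by rewrite (_ : [ffun u => _] = [ffun=> 0]) //; apply/ffunP => u; rewrite !ffunE big_nil.
    rewrite (_ : [ffun u => _] = [ffun u => f v u + [ffun u => \sum_(v <- s) f v u] u]).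
      by apply: PD => //; have [] := Hf v.
    by apply/ffunP => u; rewrite !ffunE big_cons.
  exact: Ps.
- by move=> u; rewrite ffunE; apply: sumn_bound => v; have [] := Hf v.
move=> u; rewrite ffunE; apply/idP/idP => [|pu].
  rewrite lt0n sum_nat_eq0 => /forallPn[v]; rewrite implyTb -lt0n => fvu.
  by have [_ _ _] := Hf v; apply.
by rewrite (bigD1 u) //= addn_gt0; have [_ _ -> //] := Hf u.
Qed.

Definition deg (D P L : finType) (pi : D -> P) (lab : D -> D -> L) (d : D) (i : L * P) : nat :=
  #|[pred b | (lab d b == i.1) && (pi b == i.2)]|.

Definition linval (I : finType) (cst : int) (coef : I -> int) (u : I -> nat) : int :=
  (cst + \sum_i coef i * (u i)%:Z)%R.

(* Sizes of the objects below, for [p] classes, [l] labels, [j] constraints and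
   coefficients bounded by [c]. *)
Definition sm_V p l j := l * p + 1 + j + j.
Definition sm_B1 p l j c := hilb j (sm_V p l j + c).
Definition sm_Y p l j c := (sm_B1 p l j c).+1 ^ sm_V p l j.
Definition sm_K p l j c := p * ((c.*2).+1 ^ sm_V p l j) ^ j.
Definition sm_G p l j c := sm_K p l j c * sm_Y p l j c.
Definition sm_M p l j c :=
  sm_G p l j c * hilb (p * l * p) (sm_G p l j c + sm_B1 p l j c).
Definition sm_A p l j c := sm_G p l j c * sm_M p l j c.
(** An element has one bounded vector of its own and perhaps all period vectors of its key: at most
    [sm_Y] vectors, each up to [sm_M] times, with entries up to [sm_B1]. *)
Definition sm_W p l j c :=
  sm_B1 p l j c + sm_Y p l j c * (sm_M p l j c * sm_B1 p l j c).

Lemma In_mem (T : eqType) (s : seq T) x : x \in s -> List.In x s.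
Proof. by elim: s => //= y s IHs; rewrite inE => /orP[/eqP ->|/IHs]; [left | right]. Qed.

Lemma sumr_nat_int (T : finType) (F : T -> nat) : (\sum_i (F i)%:Z)%R = Posz (\sum_i F i).
Proof. by elim/big_rec2: _ => // i y z _ ->; rewrite PoszD. Qed.

Section SmallDegrees.
Variables (D P L J : finType) (pi : D -> P) (lab : D -> D -> L) (inv : L -> L).
Variables (cst : J -> D -> int) (coef : J -> D -> L * P -> int).
Variables (cm : J -> cmp) (dl : J -> int) (c : nat).
Hypothesis invK : involutive inv.
Hypothesis labC : forall s t, lab t s = inv (lab s t).
Hypothesis le_cst : forall j d, `|cst j d| <= c.
Hypothesis le_coef : forall j d i, `|coef j d i| <= c.
Hypothesis le_dl : forall j, `|dl j| <= c.
Hypothesis le_cm : forall j, cmp_modulus (cm j) <= c.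

Let v d := deg pi lab d.
Let C := c.*2.+1.
Let V : finType := (L * P + unit + J + J)%type.
(** Elements with the same key share their class and their whole linear system, so their vectors may
    be recombined. Coefficients are stored shifted by [C], which makes the keys a finite type of
    known size. *)
Let K : finType := (P * {ffun J -> {ffun V -> 'I_(C.*2.+1)}})%type.
Let holds j d u := cmp_sat (cm j) (linval (cst j d) (coef j d) u) (dl j).
Let row (k : K) (j : J) : V -> int := fun z => ((k.2 j z)%:Z - C%:Z)%R.
Let in_v (i : L * P) : V := inl (inl (inl i)).
Let unit_v : V := inl (inl (inr tt)).

(** The unknowns are the degrees, a constant 1 and two slacks per constraint. The constant makes the
    system homogeneous, as [hilbert_basis_bound] requires; only solutions with value 1 there are
    solutions of the constraints. *)
Let rows_exist : exists (key : D -> K) (x : D -> {ffun V -> nat}),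
  [/\ forall d, (key d).1 = pi d,
      forall d j, dotz (row (key d) j) (x d) = 0%R,
      forall d, x d unit_v = 1 /\ (forall i, x d (in_v i) = v d i) &
      forall d j (y : {ffun V -> nat}), y unit_v = 1 -> dotz (row (key d) j) y = 0%R ->
        holds j d (fun i => y (in_v i)) = holds j d (v d)].
Proof.
have H1 d : exists f : J -> int * int * int * (nat * nat), forall j,
  let: (r, al, al', (u, u')) := f j in let s := linval (cst j d) (coef j d) (v d) in
  [/\ `|r| <= c.+1, `|al| <= c.+1, `|al'| <= c.+1,
      (s - r + al * u%:Z + al' * u'%:Z = 0)%R &
      forall (s' : int) (v v' : nat), (s' - r + al * v%:Z + al' * v'%:Z = 0)%R ->
        cmp_sat (cm j) s' (dl j) = cmp_sat (cm j) s (dl j)].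
  apply: (@fin_all_exists J _ (fun j (f : int * int * int * (nat * nat)) =>
    let: (r, al, al', (u, u')) := f in let s := linval (cst j d) (coef j d) (v d) in
  [/\ `|r| <= c.+1, `|al| <= c.+1, `|al'| <= c.+1,
      (s - r + al * u%:Z + al' * u'%:Z = 0)%R &
      forall (s' : int) (v v' : nat), (s' - r + al * v%:Z + al' * v'%:Z = 0)%R ->
        cmp_sat (cm j) s' (dl j) = cmp_sat (cm j) s (dl j)])) => j.
  have [r [al [al' [u [u' H]]]]] := cmp_row (linval (cst j d) (coef j d) (v d)) (le_dl j) (le_cm j).
  by exists (r, al, al', (u, u')).
have [f Hf] := fin_all_exists H1.
pose rw d j (z : V) : int := match z with
  | inl (inl (inl i)) => coef j d i
  | inl (inl (inr _)) => (cst j d - (f d j).1.1.1)%R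
  | inl (inr j') => if j' == j then (f d j).1.1.2 else 0%R
  | inr j' => if j' == j then (f d j).1.2 else 0%R
  end.
pose key d : K := (pi d, [ffun j => [ffun z => inord `|(rw d j z + C%:Z)%R| ]]).
pose x d : {ffun V -> nat} := [ffun z : V => match z with
  | inl (inl (inl i)) => v d i
  | inl (inl (inr _)) => 1
  | inl (inr j) => (f d j).2.1
  | inr j => (f d j).2.2
  end].
have le_rw d j z : `|rw d j z| <= C.
  have := Hf d j; have := le_cst j d; case E : (f d j) => [[[r al] al'] [u u']] /=.
  move=> le_c [le_r le_al le_al' _ _]; rewrite /rw /C; case: z => [[[i|_]|j']|j'].
  - by have := le_coef j d i; lia.
  - by rewrite E /=; lia.
  - by case: eqP => // _; rewrite E /=; lia.
  by case: eqP => // _; rewrite E /=; lia.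
have rowE d j : row (key d) j =1 rw d j.
  move=> z; rewrite /row /key /= !ffunE inordK; last by have := le_rw d j z; lia.
  have := le_rw d j z; lia.
have dotE d j (y : {ffun V -> nat}) : dotz (row (key d) j) y =
    (linval (cst j d) (coef j d) (fun i => y (in_v i)) - (f d j).1.1.1
      + (cst j d - (f d j).1.1.1) * ((y unit_v)%:Z - 1)
      + (f d j).1.1.2 * (y (inl (inr j)))%:Z
      + (f d j).1.2 * (y (inr j))%:Z)%R.
  rewrite /dotz (eq_bigr (fun z => (rw d j z * (y z)%:Z)%R)) => [|z _]; last by rewrite rowE.
  rewrite !big_sumType /= /linval.
  have single a (F : J -> int) : (\sum_j' (if j' == j then a else 0) * F j' = a * F j)%R.
    by rewrite (bigD1 j) //= eqxx big1 ?addr0 // => j' /negPf ->; rewrite mul0r.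
  rewrite !single.
  rewrite (big_pred1 tt) => [|[]] //.
  by rewrite /in_v /unit_v; ring.
exists key, x; split=> //.
- move=> d j; rewrite dotE !ffunE.
  have := Hf d j; case E : (f d j) => [[[r al] al'] [u u']] /= [_ _ _ + _].
  rewrite (_ : linval _ _ (fun i => x d (in_v i)) = linval (cst j d) (coef j d) (v d)); first lia.
  by rewrite /linval; congr (_ + _)%R; apply: eq_bigr => i _; rewrite ffunE.
- by move=> d; split=> [|i]; rewrite ffunE.
move=> d j y y1; rewrite dotE y1.
have := Hf d j; case E : (f d j) => [[[r al] al'] [u u']] /= [_ _ _ _ H] E0.
by rewrite subrr mulr0 addr0 in E0; apply: H E0.
Qed.

Let le_row k j z : `|row k j z| <= C.
Proof. by rewrite /row; have := ltn_ord (k.2 j z); lia. Qed.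

Let cardV : #|V| = sm_V #|P| #|L| #|J|.
Proof. by rewrite !card_sum card_prod card_unit. Qed.

Let cardK : #|K| = sm_K #|P| #|L| #|J| C.
Proof. by rewrite card_prod !card_ffun card_ord cardV. Qed.

Let small_degrees_folded : exists (A : finType) (p : A -> D) (w : A -> L -> P -> nat),
  [/\ #|A| <= sm_A #|P| #|L| #|J| C,
      forall a l b, w a l b <= sm_W #|P| #|L| #|J| C,
      forall b l b', \sum_(a | pi (p a) == b) w a l b' = \sum_(a | pi (p a) == b') w a (inv l) b,
      forall a j, holds j (p a) (fun i => w a i.1 i.2) = holds j (p a) (v (p a)) &
      forall d, exists a, pi (p a) = pi d /\ forall j, holds j d (v (p a)) = holds j d (v d)].
Proof.
have [key [x [keyE xsol x1 xkey]]] := rows_exist.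
set p' := #|P|; set l' := #|L|; set j' := #|J|.
pose B1 := sm_B1 p' l' j' C.
pose Y : finType := {ffun V -> 'I_B1.+1}.
pose emb (y : Y) : {ffun V -> nat} := [ffun z => y z : nat].
have wsE d : exists ws : seq Y,
    (forall y, y \in ws -> forall j, dotz (row (key d) j) (emb y) = 0%R) /\
    forall z, x d z = \sum_(y <- ws) (y z : nat).
  have inR a : List.In a [seq row (key d) j | j <- enum J] <-> exists j, a = row (key d) j.
    split=> [/List.in_map_iff[j [<- _]]|[j ->]]; first by exists j.
    by apply: List.in_map; apply/In_mem; rewrite mem_enum.
  have [||a /inR[j ->] //|ys Hys Hsum] := @hilbert_basis_bound (sm_V p' l' j' + C) V
      [seq row (key d) j | j <- enum J] (x d).
  - by rewrite cardV leq_addr.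
  - by move=> a z /inR[j ->]; apply: leq_trans (le_row _ _ _) (leq_addl _ _).
  have {}Hys y : y \in ys -> (forall j, dotz (row (key d) j) y = 0%R) /\ forall z, y z <= B1.
    case/Hys=> sol_y le_y; split=> [j|z]; first by apply: sol_y; apply/inR; exists j.
    by have := le_y z; rewrite size_map -cardE.
  pose ry (y : {ffun V -> nat}) : Y := [ffun z => inord (y z)].
  have ryK y : y \in ys -> emb (ry y) = y.
    by case/Hys=> _ le_y; apply/ffunP => z; rewrite !ffunE inordK // ltnS.
  exists (map ry ys); split.
    by move=> _ /mapP[y yys ->] j; rewrite ryK //; apply: (proj1 (Hys y yys)).
  move=> z; rewrite Hsum big_map !big_seq; apply: eq_bigr => y yys.
  by rewrite -{1}(ryK y yys) ffunE.
have [ws Hws] := fin_all_exists wsE => {wsE}.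
pose G : finType := (K * Y)%type.
(* [X] counts the uses of each bounded vector by the elements with a given key. The balance
   equations, true in [D] by counting edges from both ends, are linear in these multiplicities. *)
pose X : {ffun G -> nat} := [ffun g => \sum_(d | key d == g.1) count_mem g.2 (ws d)].
have sumX (F : K -> nat) z :
    \sum_(g : G) F g.1 * g.2 z * X g = \sum_d F (key d) * x d z.
  transitivity (\sum_d \sum_(g : G | key d == g.1) F g.1 * g.2 z * count_mem g.2 (ws d)).
    rewrite (exchange_big_dep predT) //=; apply: eq_bigr => g _.
    by rewrite ffunE big_distrr.
  apply: eq_bigr => d _.
  transitivity (\sum_(k | key d == k) \sum_(y : Y) F k * y z * count_mem y (ws d)).
    by rewrite pair_big /=; apply: eq_bigl => g; rewrite andbT.
  rewrite (big_pred1 (key d)) => [|k]; last by rewrite eq_sym.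
  rewrite (proj2 (Hws d)) [X in _ = _ * X]sum_count big_distrr /=.
  by apply: eq_bigr => y _; rewrite -mulnA [(y z : nat) * _]mulnC.
pose bal (t : P * L * P) (g : G) : int :=
  (((g.1.1 == t.1.1) * g.2 (in_v (t.1.2, t.2)))%:Z -
   ((g.1.1 == t.2) * g.2 (in_v (inv t.1.2, t.1.1)))%:Z)%R.
have balE t (X0 : {ffun G -> nat}) : dotz (bal t) X0 =
    ((\sum_(g : G) (g.1.1 == t.1.1) * g.2 (in_v (t.1.2, t.2)) * X0 g)%:Z -
     (\sum_(g : G) (g.1.1 == t.2) * g.2 (in_v (inv t.1.2, t.1.1)) * X0 g)%:Z)%R.
  rewrite /dotz /bal -!sumr_nat_int -sumrB; apply: eq_bigr => g _.
  by rewrite mulrBl !PoszM.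
have balX t : dotz (bal t) X = 0%R.
  rewrite balE (sumX (fun k => (k.1 == t.1.1) : nat)) (sumX (fun k => (k.1 == t.2) : nat)).
  apply/eqP; rewrite subr_eq0; apply/eqP; congr Posz.
  have sumdeg b l b' : \sum_d (pi d == b) * deg pi lab d (l, b') =
      #|[pred q : D * D | [&& pi q.1 == b, lab q.1 q.2 == l & pi q.2 == b']]|.
    transitivity (\sum_(d | pi d == b) \sum_(e | (lab d e == l) && (pi e == b')) 1).
      rewrite [RHS]big_mkcond /=; apply: eq_bigr => d _.
      by case: (pi d == b); rewrite ?mul1n ?mul0n // sum1_card.
    by rewrite pair_big_dep /= sum1_card; apply: eq_card => q; rewrite !inE.
  rewrite (eq_bigr (fun d => (pi d == t.1.1) * deg pi lab d (t.1.2, t.2))) => [|d _]; last first.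
    by rewrite keyE (proj2 (x1 d)).
  rewrite [RHS](eq_bigr (fun d => (pi d == t.2) * deg pi lab d (inv t.1.2, t.1.1))) => [|d _]; last first.
    by rewrite keyE (proj2 (x1 d)).
  rewrite !sumdeg -(card_image (f := fun q : D * D => (q.2, q.1))); last by case=> ? ? [? ?] [-> ->].
  apply: eq_card => -[d e]; rewrite !inE /=.
  apply/imageP/and3P => [[[d' e']]|[de lde ed]].
    rewrite inE /= => /and3P[h1 h2 h3] [-> ->]; split=> //.
    by rewrite labC (eqP h2).
  exists (e, d) => //; rewrite inE /=; apply/and3P; split=> //.
  by rewrite labC (eqP lde) invK.
have supp (g : G) : 0 < X g -> exists2 d, key d = g.1 & g.2 \in ws d.
  rewrite ffunE lt0n sum_nat_eq0 => /forallPn[d]; rewrite negb_imply => /andP[/eqP <- cnt].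
  by exists d => //; rewrite -has_pred1 has_count lt0n.
pose B2 := hilb #|{: P * L * P}| (#|G| + B1).
pose M := #|G| * B2.
(* Keeping the support keeps every key inhabited and introduces no vector that is foreign to its
   key. *)
have [X' [X'sol X'le X'pos]] : exists X' : {ffun G -> nat},
    [/\ forall t, dotz (bal t) X' = 0%R, forall g, X' g <= M &
        forall g, (0 < X' g) = (0 < X g)].
  have inR a : List.In a [seq bal t | t <- enum {: P * L * P}] <-> exists t, a = bal t.
    split=> [/List.in_map_iff[t [<- _]]|[t ->]]; first by exists t.
    by apply: List.in_map; apply/In_mem; rewrite mem_enum.
  have [||a /inR[t ->] //|zs Hzs Hsum] := @hilbert_basis_bound (#|G| + B1) G
      [seq bal t | t <- enum {: P * L * P}] X.
  - by rewrite leq_addr.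
  - move=> a g /inR[t ->]; apply: leq_trans (leq_addl _ _).
    have := ltn_ord (g.2 (in_v (t.1.2, t.2))); have := ltn_ord (g.2 (in_v (inv t.1.2, t.1.1))).
    by rewrite /bal; do 2!case: (_ == _); rewrite ?mul1n ?mul0n; lia.
  have [|z z' Hz Hz' t|z /Hzs[sol_z le_z]|X' [X'sol X'le X'pos]] :=
    @sum_bound_supp G B2 zs (fun z => forall t, dotz (bal t) z = 0%R).
  - by move=> t; rewrite /dotz big1 // => g _; rewrite ffunE mulr0.
  - by rewrite dotz_add Hz Hz' addr0.
  - split=> [t|g]; first by apply: sol_z; apply/inR; exists t.
    by have := le_z g; rewrite size_map -cardE.
  by exists X'; split=> // g; rewrite X'pos Hsum.
have X'supp (g : G) : 0 < X' g -> exists2 d, key d = g.1 & g.2 \in ws d.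
  by rewrite X'pos => /supp.
have X'1 (g : G) : 0 < X' g -> (g.2 unit_v : nat) <= 1.
  case/X'supp=> d _ yws; have [+ _] := x1 d; rewrite (proj2 (Hws d)) => <-.
  by rewrite (big_rem _ yws) /= leq_addr.
(* One element for each use of a vector with constant coordinate 1. Vectors with coordinate 0 are
   periods and can be added to any element with their key. *)
pose Aset := [pred a : G * 'I_M | ((a.1.2 unit_v : nat) == 1) && (a.2 < X' a.1)].
pose A : finType := {a in Aset}.
pose ka (a : A) : K := (val a).1.1.
have inhab d : exists a : A, ka a = key d.
  have [y yws y1] : exists2 y, y \in ws d & (y unit_v : nat) == 1.
    apply/hasP; have [+ _] := x1 d; rewrite (proj2 (Hws d)).
    elim: (ws d) => [|y s IHs]; rewrite ?big_nil // big_cons /=.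
    by case: (y unit_v : nat) => [|[|n]] //= /IHs.
  have X'g : 0 < X' (key d, y).
    rewrite X'pos ffunE (bigD1 d) //= addn_gt0; apply/orP; left.
    by rewrite -has_count has_pred1.
  have M_gt0 : 0 < M by apply: leq_trans X'g (X'le _).
  have aP : ((key d, y), Ordinal M_gt0) \in Aset by rewrite inE /= y1 X'g.
  by exists (exist (fun a => a \in Aset) _ aP).
have /fin_all_exists[p Hp] : forall a : A, exists d, key d = ka a.
  move=> a; have := valP a; rewrite inE => /andP[_ lt_a].
  by have [|d Ed _] := X'supp (val a).1; [apply: leq_trans lt_a | exists d].
(* The period vectors used in a class are all given to one of its elements. *)
pose lead (a : A) : bool := [pick b : A | ka b == ka a] == Some a.
pose R k z := \sum_(y : Y | (y unit_v : nat) == 0) X' (k, y) * y z.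
pose xa (a : A) z := ((val a).1.2 z : nat) + lead a * R (ka a) z.
have sum_lead k : (exists a, ka a = k) -> \sum_(a | ka a == k) lead a = 1.
  case=> a0 Ea0; case E : [pick b | ka b == k] => [b|]; last first.
    by move: E; case: pickP => // /(_ a0); rewrite Ea0 eqxx.
  have kb : ka b == k by move: E; case: pickP => // b' H [<-].
  rewrite (bigD1 b) //= {1}/lead (eqP kb) E eqxx big1 // => a /andP[/eqP kA ab].
  by rewrite /lead kA E -[Some b == _]/(b == a) eq_sym (negPf ab).
have sumA (F : K -> nat) z :
    \sum_a F (ka a) * xa a z = \sum_(g : G) F g.1 * g.2 z * X' g.
  rewrite (eq_bigr (fun a => F (ka a) * ((val a).1.2 z) + F (ka a) * (lead a * R (ka a) z))) => [|a _]; last by rewrite /xa mulnDr.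
  rewrite big_split /=.
  have -> : \sum_(a : A) F (ka a) * ((val a).1.2 z) =
      \sum_(g : G | (g.2 unit_v : nat) == 1) F g.1 * g.2 z * X' g.
    rewrite -(big_sub Aset (fun a => F a.1.1 * a.1.2 z)) /=.
    transitivity (\sum_(g : G | (g.2 unit_v : nat) == 1) \sum_(i : 'I_M | i < X' g) F g.1 * g.2 z).
      by rewrite pair_big_dep; apply: eq_bigl => a; rewrite inE.
    apply: eq_bigr => g _; rewrite sum_nat_const mulnC; congr (_ * _).
    rewrite -sum1_card -(big_ord_widen M (fun=> 1) (X'le g)).
    by rewrite sum1_card card_ord.
  have -> : \sum_(a : A) F (ka a) * (lead a * R (ka a) z) =
      \sum_(g : G | (g.2 unit_v : nat) == 0) F g.1 * g.2 z * X' g.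
    rewrite (partition_big ka xpredT) //=.
    transitivity (\sum_k \sum_(y : Y | (y unit_v : nat) == 0) F k * y z * X' (k, y)).
      apply: eq_bigr => k _.
      rewrite (eq_bigr (fun a => lead a * (F k * R k z))) => [|a /eqP ->]; last by rewrite mulnCA.
      rewrite -big_distrl /=.
      have [/existsP[a0 /eqP Ea0]|/existsPn none] := boolP [exists a, ka a == k].
        rewrite sum_lead; last by exists a0.
        rewrite mul1n big_distrr /=; apply: eq_bigr => y _.
        by rewrite -mulnA [X' _ * _]mulnC.
      rewrite big_pred0 => [|a]; last exact: negPf.
      rewrite mul0n big1 // => y _; case: (posnP (X' (k, y))) => [->|]; first by rewrite muln0.
      case/X'supp=> d Ed _; have [a Ea] := inhab d.
      by have := none a; rewrite Ea Ed eqxx.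
    by rewrite pair_big_dep /=; apply: eq_big => -[].
  rewrite [RHS](bigID (fun g : G => (g.2 unit_v : nat) == 1)) /=; congr (_ + _).
  rewrite [RHS](bigID (fun g : G => (g.2 unit_v : nat) == 0)) /= [X in _ = _ + X]big1 ?addn0.
    by apply: eq_bigl => g; case: eqP => [->|_]; rewrite ?andbF ?andbT.
  move=> g /andP[n1 n0]; case: (posnP (X' g)) => [->|/X'1]; first by rewrite muln0.
  by case: (g.2 unit_v : nat) n1 n0 => [|[]].
have EY : #|Y| = sm_Y p' l' j' C by rewrite card_ffun card_ord cardV.
have EG : #|G| = sm_G p' l' j' C by rewrite card_prod cardK EY.
have EM : M = sm_M p' l' j' C by rewrite /M /B2 EG !card_prod.
have piE a : pi (p a) = (ka a).1 by rewrite -keyE Hp.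
exists A, p, (fun a l b => xa a (in_v (l, b))); split.
- by rewrite card_sig (leq_trans (max_card _)) // card_prod card_ord EG EM.
- move=> a l b; rewrite /sm_W -EM -EY; apply: leq_add; first by rewrite -ltnS.
  apply: leq_trans (_ : R (ka a) (in_v (l, b)) <= _); first by case: (lead a); rewrite ?mul1n.
  rewrite /R big_mkcond /=; apply: sumn_bound => y; case: ifP => // _.
  by rewrite leq_mul // -ltnS.
- move=> b l b'.
  rewrite big_mkcond [RHS]big_mkcond /=.
  rewrite (eq_bigr (fun a => ((ka a).1 == b) * xa a (in_v (l, b')))) => [|a _]; last first.
    by rewrite piE; case: eqP; rewrite ?mul1n ?mul0n.
  rewrite [RHS](eq_bigr (fun a => ((ka a).1 == b') * xa a (in_v (inv l, b)))) => [|a _]; last first.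
    by rewrite piE; case: eqP; rewrite ?mul1n ?mul0n.
  rewrite (sumA (fun k => (k.1 == b) : nat)) (sumA (fun k => (k.1 == b') : nat)).
  by have := X'sol (b, l, b'); rewrite balE => /eqP; rewrite subr_eq0 => /eqP [].
- move=> a j.
  have := valP a; rewrite inE => /andP[/eqP ya1 lt_a].
  have sol_y (y : Y) : 0 < X' (ka a, y) -> dotz (row (ka a) j) (emb y) = 0%R.
    case/X'supp=> d /= <- yws; exact: (proj1 (Hws d)).
  have sol_ya : dotz (row (ka a) j) (emb (val a).1.2) = 0%R.
    by apply: sol_y; rewrite /ka -surjective_pairing; apply: leq_trans lt_a.
  pose z : {ffun Y -> nat} :=
    [ffun y : Y => if (y unit_v : nat) == 0 then lead a * X' (ka a, y) else 0].
  have ER u : \sum_y z y * emb y u = lead a * R (ka a) u.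
    rewrite big_distrr [RHS]big_mkcond /=; apply: eq_bigr => y _; rewrite !ffunE.
    by case: ifP => // _; rewrite mulnA.
  rewrite -(xkey (p a) j [ffun u => emb (val a).1.2 u + [ffun u => \sum_y z y * emb y u] u]).
  - by congr (cmp_sat _ (_ + _)%R _); apply: eq_bigr => -[l b] _; rewrite !ffunE ER.
  - rewrite !ffunE ER ya1 /R big1 ?muln0 // => y /eqP ->.
    by rewrite muln0.
  rewrite dotz_add Hp sol_ya add0r dotz_comp /dotz big1 // => y _.
  rewrite [z y]ffunE; case: ifP => _; last by rewrite mulr0.
  case: (posnP (X' (ka a, y))) => [->|/sol_y]; first by rewrite muln0 mulr0.
  by rewrite /dotz => ->; rewrite mul0r.
move=> d; have [a Ea] := inhab d; exists a; split; first by rewrite piE Ea keyE.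
move=> j; have [xp1 xpv] := x1 (p a).
rewrite -(xkey d j (x (p a))) //; last by rewrite -Ea -Hp xsol.
by congr (cmp_sat _ (_ + _)%R _); apply: eq_bigr => i _; rewrite xpv.
Qed.

Theorem small_degrees : exists (A : finType) (p : A -> D) (w : A -> L -> P -> nat),
  [/\ #|A| <= sm_A #|P| #|L| #|J| c.*2.+1,
      forall a l b, w a l b <= sm_W #|P| #|L| #|J| c.*2.+1,
      forall b l b', \sum_(a | pi (p a) == b) w a l b' = \sum_(a | pi (p a) == b') w a (inv l) b,
      forall a j,
        cmp_sat (cm j) (linval (cst j (p a)) (coef j (p a)) (fun i => w a i.1 i.2)) (dl j) =
        cmp_sat (cm j) (linval (cst j (p a)) (coef j (p a)) (deg pi lab (p a))) (dl j) &
      forall d, exists a, pi (p a) = pi d /\ forall j,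
        cmp_sat (cm j) (linval (cst j d) (coef j d) (deg pi lab (p a))) (dl j) =
        cmp_sat (cm j) (linval (cst j d) (coef j d) (deg pi lab d)) (dl j)].
Proof. exact: small_degrees_folded. Qed.
End SmallDegrees.

(** * Preservation of formulas *)

Definition atom_form (g : gatom) := match g with AU A u => FU A u | AB R u v => FB R u v end.

Lemma atom_satE (D : finType) (U : nat -> pred D) B e g : atom_sat U B e g = sat U B e (atom_form g).
Proof. by case: g. Qed.

Lemma atom_hasE g w : atom_has g w = fv (atom_form g) w.
Proof. by case: g. Qed.

Lemma sat_ex (D : finType) (U : nat -> pred D) B (e : var -> D) vs a f :
  sat U B e (FEx vs a f) <->
  exists2 e' : var -> D, (forall v : var, v \notin vs -> e' v = e v) &
    atom_sat U B e' a && sat U B e' f.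
Proof. exact: exvE. Qed.

Section WellFormed.
Variables (N : nat) (Good : gpform -> Prop).

Definition atom_lt (a : gatom) := match a with AU A _ => A < N | AB R _ _ => R < N end.

Fixpoint wf (g : gpform) : Prop := Good g /\
  match g with
  | FU A _ => A < N
  | FB R _ _ => R < N
  | FEq _ _ => True
  | FNeg f => wf f
  | FAnd f g => wf f /\ wf g
  | FEx vs a f => [/\ Good (atom_form a), atom_lt a,
                      wf f & forall w, fv f w -> atom_has a w]
  | FCount v ts c d => wf_terms ts
  end
with wf_terms (ts : pterms) : Prop :=
  match ts with
  | PNil => True
  | PCons lam R inv f ts => [/\ R < N, wf f & wf_terms ts]
  end.

Lemma wf_good g : wf g -> Good g. Proof. by case: g => [A u|R u v|u v|f|f g|vs a f|v ts c d] []. Qed.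

(** All roles between two elements, in both directions; the boolean marks inverse roles. The empty
    label stands for non-adjacency. *)
Definition label : finType := {set 'I_N * bool}.
Definition inv_label (l : label) : label := [set x | (x.1, ~~ x.2) \in l].
Definition in_label R inv (l : label) := [exists i : 'I_N, (i == R :> nat) && ((i, inv) \in l)].

Lemma inv_labelK : involutive inv_label.
Proof. by move=> l; apply/setP => -[i b]; rewrite !inE /= negbK. Qed.

Lemma in_label_ord (i : 'I_N) inv l : in_label i inv l = ((i, inv) \in l).
Proof.
apply/existsP/idP => [[j /andP[/eqP ij]]|il]; last by exists i; rewrite eqxx.
by rewrite (ord_inj ij).
Qed.

Lemma in_label0 R inv : in_label R inv set0 = false.
Proof. by apply/existsP => -[i]; rewrite inE andbF. Qed.

Lemma in_inv_label R inv l : in_label R inv (inv_label l) = in_label R (~~ inv) l.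
Proof. by apply: eq_existsb => i; rewrite inE. Qed.

Section Label.
Variables (D : finType) (B : nat -> rel D).

(** Loops are excluded, so that labels describe a loop-free graph; the colours below record them
    instead. *)
Definition lab (a b : D) : label :=
  if a == b then set0 else [set x : 'I_N * bool | role B x.1 x.2 a b].

Lemma labC a b : lab b a = inv_label (lab a b).
Proof.
rewrite /lab eq_sym; case: eqP => _; apply/setP => -[i x]; rewrite !inE //=.
by case: x.
Qed.

Lemma lab_refl a : lab a a = set0. Proof. by rewrite /lab eqxx. Qed.

Lemma roleE R inv a b : R < N -> a != b -> role B R inv a b = in_label R inv (lab a b).
Proof.
move=> ltR /negPf ab; rewrite -[R]/(val (Ordinal ltR)) in_label_ord /lab ab inE.
by case: inv.
Qed.
End Label.
End WellFormed.

Section Preservation.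
Variables (D : finType) (U : nat -> pred D) (B : nat -> rel D) (N : nat).
Variables (P : finType) (pi : D -> P) (Good : gpform -> Prop).
Hypothesis good_pi : forall g a b, Good g -> pi a = pi b ->
  sat U B (fun=> a) g = sat U B (fun=> b) g.

Notation lab := (lab N B).
Let L := label N.
Notation wf := (wf N Good).

Lemma both_or_single g : (forall v, fv g v) \/ exists v, forall w, fv g w -> w = v.
Proof.
case Ef : (fv g false); case Et : (fv g true); first by left=> -[].
- by right; exists false => -[] //; rewrite Et.
- by right; exists true => -[] //; rewrite Ef.
by right; exists true => -[] //; rewrite Ef.
Qed.

Lemma sat_single v g e1 e2 : Good g -> (forall w, fv g w -> w = v) ->
  (fv g v -> pi (e1 v) = pi (e2 v)) -> sat U B e1 g = sat U B e2 g.
Proof.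
move=> Gg fvg Epi; case Ev : (fv g v); last first.
  by apply: sat_fv => w fw; move: Ev; rewrite -(fvg w fw) fw.
transitivity (sat U B (fun=> e1 v) g); first by apply: sat_fv => w /fvg ->.
rewrite (good_pi Gg (Epi Ev)); apply: sat_fv => w /fvg -> //.
Qed.

Lemma sat_diag g e1 e2 : Good g -> (forall v, e1 v = e1 false) -> (forall v, e2 v = e2 false) ->
  pi (e1 false) = pi (e2 false) -> sat U B e1 g = sat U B e2 g.
Proof.
move=> Gg E1 E2 Epi.
rewrite (sat_fv _ _ (g := g) (e1 := e1) (e2 := fun=> e1 false)) => [|w _]; last exact: E1.
by rewrite (good_pi Gg Epi); apply: sat_fv => w _; rewrite E2.
Qed.

(** Only atoms can compare two distinct elements: a quantified formula with both variables free
    binds nothing, and a counting formula has one free variable. Good formulas in one variable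
    depend on its class by [good_pi]. *)
Lemma sat_lab g e1 e2 : wf g ->
  (forall v, pi (e1 v) = pi (e2 v)) ->
  lab (e1 false) (e1 true) = lab (e2 false) (e2 true) ->
  lab (e2 false) (e2 true) != set0 -> sat U B e1 g = sat U B e2 g.
Proof.
move=> wg Epi Elab ne.
have neq1 : e1 false != e1 true by apply: contraNneq ne => E; rewrite -Elab E lab_refl.
have neq2 : e2 false != e2 true by apply: contraNneq ne => E; rewrite E lab_refl.
have atomE R u v : R < N -> pi (e1 u) = pi (e2 u) -> Good (FB R u v) ->
    B R (e1 u) (e1 v) = B R (e2 u) (e2 v).
  move=> ltR Epu Gg; have [uv|uv] := eqVneq u v.
    by apply: (sat_single (v := u) (g := FB R u v)) => //= w; rewrite -uv orbb => /eqP.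
  have -> : v = ~~ u by case: u v uv {Gg Epu} => [] [].
  rewrite -[B R _ _]/(role B R false _ _) -[in RHS]/(role B R false _ _).
  have neq w : e1 w != e1 (~~ w) /\ e2 w != e2 (~~ w).
    by case: w => //=; rewrite ![_ true == _]eq_sym.
  have [n1 n2] := neq u; rewrite !(@roleE N) //.
  by case: u {uv Gg Epu n1 n2} => /=; rewrite ?Elab // labC [in RHS]labC Elab.
elim: g wg => [A u|R u v|u v|f IHf|f IHf g IHg|vs a f IHf|v ts c d] wg; have Gg := wf_good wg.
- by apply: (sat_single (v := u)) => // w /eqP.
- by rewrite /= (atomE R u v) //; case: wg.
- rewrite /=; case: u v {wg Gg} => [] []; rewrite ?eqxx // ?(negPf neq1) ?(negPf neq2) //.
  by rewrite !(eq_sym (_ true)) (negPf neq1) (negPf neq2).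
- by rewrite /= IHf //; case: wg.
- by rewrite /= IHf ?IHg //; case: wg => _ [].
- have [bg|[v fvv]] := both_or_single (FEx vs a f); last first.
    by apply: (sat_single (v := v)) => //.
  have vs0 : vs = [::].
    case: vs bg {wg Gg} => // v vs /(_ v) /andP[_].
    by rewrite inE eqxx.
  case: wg => _ [Ga wa wf_f _]; rewrite vs0 /= IHf //; congr (_ && _).
  case: a Ga wa {bg Gg} => [A u|R u v] /= Ga wa; last exact: atomE.
  by apply: (sat_single (v := u) (g := FU A u)) => // w /eqP.
by apply: (sat_single (v := v)) => // w /eqP.
Qed.

(** The contribution of [d] itself to the sum, which the labels cannot see as they ignore loops. *)
Fixpoint pconst (d : D) (v : var) (ts : pterms) : int :=
  if ts is PCons lam R inv f ts then
    (lam * (role B R inv d d && sat U B (fun=> d) f)%:Z + pconst d v ts)%R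
  else 0%R.

Definition pair_env (v : var) (T : Type) (d b : T) : var -> T := fun w => if w == v then d else b.

(** One witness [b] speaks for all: by [sat_lab] the elements with this nonempty label and this
    class agree. *)
Definition holds_at (d : D) (v : var) (f : gpform) (i : L * P) : bool :=
  [exists b, [&& lab d b == i.1, pi b == i.2 & sat U B (pair_env v d b) f]].

Fixpoint pcoef (d : D) (v : var) (ts : pterms) (i : L * P) : int :=
  if ts is PCons lam R inv f ts then
    (lam * (in_label R inv i.1 && holds_at d v f i)%:Z + pcoef d v ts i)%R
  else 0%R.

Section Copy.
Variables (E : finType) (U' : nat -> pred E) (B' : nat -> rel E) (p : E -> D) (lab' : E -> E -> L).
Hypothesis role_edge : forall R inv s t, R < N -> s != t ->
  role B' R inv s t = in_label R inv (lab' s t).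
Hypothesis role_loop : forall R inv s, R < N -> role B' R inv s s = role B R inv (p s) (p s).
Hypothesis lab'_refl : forall s, lab' s s = set0.
Hypothesis lab'C : forall s t, lab' t s = inv_label (lab' s t).
Hypothesis forth : forall s t, lab' s t != set0 ->
  exists2 b, lab (p s) b = lab' s t & pi b = pi (p t).

Definition preserved g := forall e' e,
  (forall w, pi (e w) = pi (p (e' w))) ->
  ((forall w, e' w = e' false) /\ (forall w, e w = e false)) \/
  (lab (e false) (e true) = lab' (e' false) (e' true) /\ lab' (e' false) (e' true) != set0) ->
  sat U' B' e' g = sat U B e g.

Fixpoint preserved_terms ts :=
  if ts is PCons _ _ _ f ts then preserved f /\ preserved_terms ts else True.

Lemma lab'_sym e' (e : var -> D) v :
  lab (e v) (e (~~ v)) = lab' (e' v) (e' (~~ v)) -> lab' (e' v) (e' (~~ v)) != set0 ->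
  lab (e false) (e true) = lab' (e' false) (e' true) /\ lab' (e' false) (e' true) != set0.
Proof.
case: v => //= E1 E2; rewrite labC E1 -lab'C; split=> //.
by apply: contraNneq E2 => E0; rewrite lab'C E0; apply/eqP/setP => x; rewrite !inE.
Qed.

Lemma upd_pair e' (v : var) (t : E) : upd e' (~~ v) t =1 pair_env v (e' v) t.
Proof. by move=> w; rewrite /upd /pair_env; case: v w => [] []. Qed.

(** Neighbours are grouped by label and class, and within a group [f] has one truth value. Taking
    the copy to be [D] itself, with [id] for [p], yields [psum_self]. *)
Lemma psum_linear e' v ts : wf_terms N Good ts -> preserved_terms ts ->
  psum U' B' e' v ts = linval (pconst (p (e' v)) v ts) (pcoef (p (e' v)) v ts)
                              (deg (fun t => pi (p t)) lab' (e' v)).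
Proof.
set s := e' v; set d := p s.
elim: ts => [|lam R inv f ts IHts] /=.
  by move=> _ _; rewrite /linval big1 ?addr0 // => i _; rewrite mul0r.
case=> ltR wff wts [pf pts]; rewrite {}IHts //.
pose Q i := in_label R inv i.1 && holds_at d v f i.
have -> : #|[pred b | role B' R inv s b && sat U' B' (upd e' (~~ v) b) f]| =
    (role B R inv d d && sat U B (fun=> d) f) + \sum_i Q i * deg (fun t => pi (p t)) lab' s i.
  transitivity (\sum_t ((t == s) && (role B R inv d d && sat U B (fun=> d) f)
                  + Q (lab' s t, pi (p t)))).
    rewrite -sum1_card big_mkcond /=; apply: eq_bigr => t _; rewrite inE.
    rewrite (sat_fv _ _ (e2 := pair_env v s t)) => [|w _]; last exact: upd_pair.
    have [->|ts_neq] := eqVneq t s.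
      rewrite /Q lab'_refl in_label0 /= addn0 role_loop //.
      rewrite (pf _ (fun=> d)); first by case: (_ && _).
        by move=> w; rewrite /pair_env; case: ifP.
      by left; split=> // w; rewrite /pair_env !if_same.
    rewrite add0n role_edge 1?eq_sym // /Q /=.
    case Rl : (in_label R inv (lab' s t)) => //=.
    have ne : lab' s t != set0 by apply: contraTneq Rl => ->; rewrite in_label0.
    have [b lab_b pi_b] := forth ne.
    have Esat b' : lab d b' = lab' s t -> pi b' = pi (p t) ->
        sat U' B' (pair_env v s t) f = sat U B (pair_env v d b') f.
      move=> El Ep; apply: pf => [w|]; first by rewrite /pair_env; case: ifP.
      right; apply: (@lab'_sym _ _ v); rewrite /pair_env eqxx; case: (v) => //=.
    rewrite (_ : holds_at _ _ _ _ = sat U' B' (pair_env v s t) f); first by case: (sat _ _ _ _).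
    apply/existsP/idP => [[b' /and3P[/eqP l1 /eqP l2]]|sf]; first by rewrite (Esat b').
    by exists b; rewrite lab_b pi_b !eqxx -(Esat b).
  rewrite big_split /=; congr (_ + _).
    by rewrite (bigD1 s) //= eqxx big1 ?addn0 // => t /negPf ->.
  rewrite (partition_big (fun t => (lab' s t, pi (p t))) xpredT) //=.
  apply: eq_bigr => -[l c] _; rewrite (eq_bigr (fun=> (Q (l, c) : nat))) => [|t /eqP [-> ->] //].
  rewrite sum_nat_const mulnC; congr (_ * _).
rewrite /linval PoszD -sumr_nat_int mulrDr -!addrA; congr (_ + _)%R.
rewrite addrCA; congr (_ + _)%R; rewrite mulr_sumr -big_split /=; apply: eq_bigr => i _.
by rewrite mulrDl PoszM mulrA.
Qed.


Hypothesis U'E : forall A s, A < N -> U' A s = U A (p s).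
Hypothesis back : forall s b, lab (p s) b != set0 ->
  exists2 t, lab' s t = lab (p s) b & pi (p t) = pi b.
Hypothesis cover : forall a, exists s, pi (p s) = pi a.
Hypothesis cover_edge : forall a b, lab a b != set0 ->
  exists s t, [/\ lab' s t = lab a b, pi (p s) = pi a & pi (p t) = pi b].

Lemma preserved_atom g : wf (atom_form g) -> preserved (atom_form g).
Proof.
case: g => [A u|R u v] /= [Gg lt_N] e' e Epi Hm /=.
  rewrite U'E // -[U A (e u)]/(sat U B (fun=> e u) (FU A u)) (good_pi Gg (Epi u)) //.
have loop w : B' R (e' w) (e' w) = B R (e w) (e w).
  have := good_pi Gg (Epi w) => /= ->; exact: (role_loop false).
have [->|uv] := eqVneq u v; first exact: loop.
have {uv} -> : v = ~~ u by case: u v uv {Gg} => [] [].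
case: Hm => [[E1 E2]|[Elab ne]].
  have -> : e' (~~ u) = e' u by rewrite E1 [RHS]E1.
  by have -> : e (~~ u) = e u by rewrite E2 [RHS]E2.
have ne' w : e' w != e' (~~ w).
  by case: w => /=; apply: contraNneq ne => E0; rewrite ?E0 ?lab'_refl // -E0 lab'_refl.
have ne0 w : e w != e (~~ w).
  by rewrite -Elab in ne; case: w => /=; apply: contraNneq ne => E0; rewrite ?E0 ?lab_refl // -E0 lab_refl.
rewrite -[B' R _ _]/(role B' R false _ _) -[B R _ _]/(role B R false _ _).
rewrite role_edge // (@roleE N) //.
by case: u {Gg} => /=; rewrite ?Elab // lab'C labC Elab.
Qed.

Lemma guard_env (T : eqType) (a : gatom) (e : var -> T) :
  (exists s, forall w, atom_has a w -> e w = s) \/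
  (e false != e true /\ forall w, atom_has a w).
Proof.
case: a => [A u|R u v] /=; first by left; exists (e u) => w /eqP ->.
have [Ee|ne] := eqVneq (e u) (e v).
  by left; exists (e u) => w /orP[/eqP -> //|/eqP ->].
right; split; first by case: u v ne => [] []; rewrite ?eqxx // eq_sym.
by case: u v ne => [] []; rewrite ?eqxx // => _ [].
Qed.

Lemma guard_edge (T : finType) (UT : nat -> pred T) (BT : nat -> rel T) (labT : T -> T -> L) a (e : var -> T) :
  (forall R inv s t, R < N -> s != t -> role BT R inv s t = in_label R inv (labT s t)) ->
  atom_lt N a ->
  (forall s t, labT t s = inv_label (labT s t)) ->
  e false != e true -> (forall w, atom_has a w) -> atom_sat UT BT e a ->
  forall w, labT (e w) (e (~~ w)) != set0.
Proof.
move=> roleT wa labTC ne full sa w.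
have labT0 s t : labT s t = set0 -> labT t s = set0.
  by move=> E0; rewrite labTC E0; apply/setP => x; rewrite !inE.
suff: labT (e false) (e true) != set0.
  by case: w => //=; apply: contra_neq => /labT0.
case: a wa full sa => [A u|R u v] /= wa full; first by have := full true; have := full false; case: (u).
have [uv|uv] := eqVneq u v; first by have := full true; have := full false; rewrite -uv; case: (u).
rewrite -[BT _ _ _]/(role BT R false _ _) roleT //; last first.
  by case: u v uv {full} => [] [] // _; rewrite // eq_sym.
case: u v uv {full} => [] [] // _ inl; apply: contraTneq inl => E0.
  by rewrite (labT0 _ _ E0) in_label0.
by rewrite E0 in_label0.
Qed.

(** A satisfied guard gives one value to all its variables, or it has both variables with distinct
    values, which then form an edge. A single value is carried over by [p] or pulled back by
    [cover]. An edge is carried over by [forth] and pulled back by [back] if one end is fixed, by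
    [cover_edge] if none is. *)
Lemma preserved_ex vs a f : wf (FEx vs a f) -> preserved f -> preserved (FEx vs a f).
Proof.
move=> wg pf e' e Epi Hm; have [Gg [Ga wa wff fva]] := wg.
have pa : preserved (atom_form a) by apply: preserved_atom; case: a Ga wa {wg Gg fva} => *; split.
have [bg|[v0 fv0]] := both_or_single (FEx vs a f).
  have vs0 : vs = [::].
    by case: vs bg {wg Gg} => // v vs /(_ v) /andP[_]; rewrite inE eqxx.
  by rewrite vs0 /= (pf _ _ Epi Hm) !atom_satE (pa _ _ Epi Hm).
set s0 := e' v0; set d0 := p s0.
have free w : atom_has a w -> w \notin vs -> w = v0.
  by move=> aw wvs; apply: fv0; rewrite /= aw wvs.
have other : (forall w, atom_has a w) -> ~~ v0 \in vs.
  by move=> full; apply/negPn/negP => /(free _ (full _)); case: (v0).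
have -> : sat U' B' e' (FEx vs a f) = sat U' B' (fun=> s0) (FEx vs a f).
  by apply: sat_fv => w /fv0 ->.
have -> : sat U B e (FEx vs a f) = sat U B (fun=> d0) (FEx vs a f).
  by apply: (sat_single (v := v0)).
have agree (T : finType) (UT : nat -> pred T) BT (e1 e2 : var -> T) :
    (forall w, atom_has a w -> e1 w = e2 w) ->
    atom_sat UT BT e1 a && sat UT BT e1 f = atom_sat UT BT e2 a && sat UT BT e2 f.
  move=> E12; congr (_ && _); last by apply: sat_fv => w /fva /E12.
  by rewrite !atom_satE; apply: sat_fv => w; rewrite -atom_hasE => /E12.
have pboth h' h : (forall w, pi (h w) = pi (p (h' w))) ->
    ((forall w, h' w = h' false) /\ (forall w, h w = h false)) \/
    (lab (h false) (h true) = lab' (h' false) (h' true) /\ lab' (h' false) (h' true) != set0) ->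
    atom_sat U' B' h' a && sat U' B' h' f = atom_sat U B h a && sat U B h f.
  by move=> h1 h2; rewrite !atom_satE (pf _ _ h1 h2) (pa _ _ h1 h2).
apply/idP/idP => /sat_ex[e1 He1 sat1]; apply/sat_ex.
- have [[s Hs]|[ne full]] := guard_env a e1.
    exists (fun w => if w \in vs then p s else d0) => [w /negPf -> //|].
    rewrite -(agree _ U B (fun=> p s)) => [|w aw]; last first.
      by case: ifPn => // wvs; rewrite -(Hs w aw) He1.
    rewrite -(pboth (fun=> s)) //; last by left.
    by rewrite -(agree _ U' B' e1) // => w /Hs.
  have edge := guard_edge role_edge wa lab'C ne full (proj1 (andP sat1)).
  have [b lab_b pi_b] := forth (edge v0).
  exists (pair_env v0 (p (e1 v0)) b).
    move=> w wvs; rewrite /pair_env (free w) // eqxx He1 //.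
    by rewrite -(free w).
  rewrite -(pboth e1) // => [w|].
    rewrite /pair_env; case: (eqVneq w v0) => [-> //|wv].
    by have -> : w = ~~ v0 by move: wv; case: (w); case: (v0).
  right; apply: (@lab'_sym _ _ v0); last exact: edge.
  by rewrite /pair_env eqxx -lab_b; case: (v0).
- have [[d Hd]|[ne full]] := guard_env a e1.
    have [s pi_s Hs] : exists2 s, pi (p s) = pi d & forall w, atom_has a w -> w \notin vs -> s = s0.
      have [/existsP[w /andP[aw wvs]]|/existsPn none] := boolP [exists w, atom_has a w && (w \notin vs)].
        by exists s0 => //; rewrite -(Hd w aw) He1.
      have [s pi_s] := cover d; exists s => // w aw wvs.
      by have := none w; rewrite aw wvs.
    exists (fun w => if w \in vs then s else s0) => [w /negPf -> //|].
    rewrite -(agree _ U' B' (fun=> s)) => [|w aw]; last first.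
      by case: ifPn => // /(Hs w aw).
    rewrite (pboth (fun=> s) (fun=> d)) //; last by left.
    by rewrite -(agree _ U B e1) // => w /Hd.
  have edge := guard_edge (@roleE N D B) wa (@labC N D B) ne full (proj1 (andP sat1)).
  have [s [t [lab_st pi_s pi_t Hs]]] : exists s t, [/\ lab' s t = lab (e1 v0) (e1 (~~ v0)),
      pi (p s) = pi (e1 v0), pi (p t) = pi (e1 (~~ v0)) & v0 \notin vs -> s = s0].
    case: (boolP (v0 \in vs)) => v0vs.
      by have [s [t [h1 h2 h3]]] := cover_edge (edge v0); exists s, t.
    have E1 : e1 v0 = p s0 by rewrite He1.
    have [|t h1 h2] := @back s0 (e1 (~~ v0)); first by rewrite -E1 edge.
    by exists s0, t; rewrite E1.
  exists (pair_env v0 s t).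
    move=> w wvs; have Ew := free w (full w) wvs.
    by rewrite /pair_env Ew eqxx Hs // -Ew.
  rewrite (pboth _ e1) // => [w|].
    rewrite /pair_env; case: (eqVneq w v0) => [-> //|wv].
    by have -> : w = ~~ v0 by move: wv; case: (w); case: (v0).
  right; apply: (@lab'_sym _ _ v0).
    by rewrite /pair_env eqxx -lab_st; case: (v0).
  rewrite /pair_env eqxx; have := edge v0; rewrite -lab_st.
  by case: (v0).
Qed.


Hypothesis same_counts : forall s v ts c delta, Good (FCount v ts c delta) ->
  cmp_sat c (linval (pconst (p s) v ts) (pcoef (p s) v ts) (deg (fun t => pi (p t)) lab' s)) delta =
  cmp_sat c (linval (pconst (p s) v ts) (pcoef (p s) v ts) (deg pi lab (p s))) delta.
Hypothesis psum_self : forall e v ts, wf_terms N Good ts ->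
  psum U B e v ts = linval (pconst (e v) v ts) (pcoef (e v) v ts) (deg pi lab (e v)).

Lemma preserved_all :
  (forall g, wf g -> preserved g) /\ (forall ts, wf_terms N Good ts -> preserved_terms ts).
Proof.
apply: gpform_mutind.
- by move=> A u wg; apply: (@preserved_atom (AU A u)).
- by move=> R u v wg; apply: (@preserved_atom (AB R u v)).
- move=> u v _ e' e _ Hm /=; have [->|uv] := eqVneq u v; first by rewrite !eqxx.
  have {uv} -> : v = ~~ u by case: u v uv => [] [].
  case: Hm => [[E1 E2]|[Elab ne]].
    by rewrite E1 [e' (~~ u)]E1 E2 [e (~~ u)]E2 !eqxx.
  have n1 : e' false != e' true by apply: contraNneq ne => ->; rewrite lab'_refl.
  have n2 : e false != e true.
    by rewrite -Elab in ne; apply: contraNneq ne => ->; rewrite lab_refl.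
  by case: u => /=; rewrite ?(eq_sym (_ true)) (negPf n1) (negPf n2).
- by move=> f IHf [_ wff] e' e Epi Hm /=; rewrite (IHf wff e' e).
- by move=> f IHf g IHg [_ [wff wfg]] e' e Epi Hm /=; rewrite (IHf wff e' e) ?(IHg wfg e' e).
- by move=> vs a f IHf wg; apply: preserved_ex => //; apply: IHf; case: wg => _ [].
- move=> v ts IHts c delta [Gg wts] e' e Epi Hm.
  have -> : sat U B e (FCount v ts c delta) = sat U B (fun=> p (e' v)) (FCount v ts c delta).
    by apply: (sat_single (v := v)) => // w /eqP.
  rewrite /= psum_linear //; last exact: IHts.
  by rewrite (psum_self (fun=> p (e' v))) // same_counts.
- by [].
by move=> lam R inv f IHf ts IHts [_ wff wts]; split; [apply: IHf | apply: IHts].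
Qed.

End Copy.

Lemma psum_self e v ts : wf_terms N Good ts ->
  psum U B e v ts = linval (pconst (e v) v ts) (pcoef (e v) v ts) (deg pi lab (e v)).
Proof.
move=> wts; apply: (@psum_linear D U B id lab) => //.
- by move=> R inv s t; apply: roleE.
- by move=> s; apply: lab_refl.
- by move=> s t; apply: labC.
- by move=> s t _; exists t.
elim: ts wts => //= lam R inv f ts IHts [_ wff wts]; split; last exact: IHts.
move=> e' e0 Epi [[E1 E2]|[Elab ne]].
  by apply: sat_diag; first exact: wf_good wff.
by apply: sat_lab; rewrite // Elab.
Qed.
End Preservation.

(** * Local homomorphisms *)

(** The values of [tp] at depth [k]: a finite type that depends on colours and labels only, whence
    the bound on the number of classes. *)
Fixpoint tower (C L : finType) k : finType :=
  if k is k'.+1 then (tower C L k' * {set L * tower C L k'})%type else C.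

Section Types.
Variables (C L D : finType) (l0 : L) (color : D -> C) (lab : D -> D -> L).

Fixpoint tp k (d : D) : tower C L k :=
  if k is k'.+1 then
    (tp k' d, [set x | [exists b, (lab d b != l0) && (x == (lab d b, tp k' b))]])
  else color d.

Lemma tp_le k m a b : k <= m -> tp m a = tp m b -> tp k a = tp k b.
Proof.
elim: m => [|m IHm]; first by rewrite leqn0 => /eqP ->.
rewrite leq_eqVlt => /orP[/eqP -> //|]; rewrite ltnS => le_k [E _].
exact: IHm.
Qed.

Lemma tp_step k a b x : tp k.+1 a = tp k.+1 b -> lab a x != l0 ->
  exists2 y, lab b y = lab a x & tp k y = tp k x.
Proof.
case=> _ /setP/(_ (lab a x, tp k x)); rewrite !inE => E ne.
have : [exists y, (lab a y != l0) && ((lab a x, tp k x) == (lab a y, tp k y))].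
  by apply/existsP; exists x; rewrite ne eqxx.
rewrite E => /existsP[y /andP[_ /eqP[-> ->]]]; by exists y.
Qed.
End Types.

Section Forest.
Variables (E L : finType) (l0 : L) (lab' : E -> E -> L) (n : nat).
Hypothesis girth : forall k (s : nat -> E), 0 < k <= n ->
  (forall i, i < k -> lab' (s i) (s i.+1) != l0) ->
  (forall i, i.+2 <= k -> s i != s i.+2) -> s k != s 0.

(** Otherwise a walk inside [S] can always be continued without turning back; it repeats a vertex
    within [#|S|] steps, against [girth]. *)
Lemma exists_leaf (S : {set E}) : S != set0 -> #|S| <= n ->
  exists2 s, s \in S & forall t t', t \in S -> t' \in S ->
    lab' s t != l0 -> lab' s t' != l0 -> t = t'.
Proof.
move=> /set0Pn[s0 s0S] le_S.
pose leaf s := [forall t, forall t', [&& t \in S, t' \in S, lab' s t != l0 & lab' s t' != l0] ==> (t == t')].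
have [/existsP[s /andP[sS /forallP lf]]|/existsPn nl] := boolP [exists s, (s \in S) && leaf s].
  exists s => // t t' tS t'S st st'; apply/eqP.
  by have /forallP/(_ t')/implyP := lf t; apply; rewrite tS t'S st.
exfalso.
have /fin_all_exists[nx Hnx] : forall x : E * E, exists t,
    x.2 \in S -> [/\ t \in S, lab' x.2 t != l0 & x.1 != t].
  case=> s s' /=; case: (boolP (s' \in S)) => sS; last by exists s.
  have := nl s'; rewrite sS /= negb_forall => /existsP[t].
  rewrite negb_forall => /existsP[t']; rewrite negb_imply => /andP[/and4P[tS t'S l1 l2] tt'].
  have [->|st] := eqVneq s t; first by exists t'.
  by exists t.
pose st i := iter i (fun x => (x.2, nx x)) (s0, s0).
pose w i := (st i).2.
have wS i : w i \in S.
  rewrite /w; elim: i => //= i IHi; by have [] := Hnx (st i) IHi.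
have w1 i : (st i.+1).1 = w i by [].
have adj i : lab' (w i) (w i.+1) != l0 by have [] := Hnx (st i) (wS i).
have nb i : w i != w i.+2 by have [] := Hnx (st i.+1) (wS i.+1).
have [i [j [lt_ij le_j Ew]]] : exists i j, [/\ i < j, j <= #|S| & w i = w j].
  have /injectivePn[i [j ij Ew]] : ~~ injectiveb (fun i : 'I_(#|S|).+1 => (Sub (w i) (wS i) : {x | x \in S})).
    apply/negP => /injectiveP/leq_card; rewrite card_ord card_sig.
    by rewrite (eq_card (B := mem S)) ?ltnn // => x; rewrite inE.
  have {}Ew : w i = w j by case: Ew.
  case: (ltngtP i j) => [lt|lt|E0].
  - by exists i, j; split=> //; rewrite -ltnS ltn_ord.
  - by exists j, i; split=> //; rewrite -ltnS ltn_ord.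
  by rewrite (ord_inj E0) eqxx in ij.
have := @girth (j - i) (fun k => w (i + k)).
rewrite subnKC ?(ltnW lt_ij) // addn0 Ew eqxx => H.
have: false; last by [].
apply: H => [|k _|k _]; first by lia.
  by rewrite addnS.
by rewrite !addnS.
Qed.

Variables (C D : finType) (color : D -> C) (lab : D -> D -> L) (inv : L -> L) (p : E -> D).
Hypothesis inv0 : inv l0 = l0.
Hypothesis labC : forall a b, lab b a = inv (lab a b).
Hypothesis lab'C : forall s t, lab' t s = inv (lab' s t).
Hypothesis lab'_refl : forall s, lab' s s = l0.
Notation tp := (tp l0 color lab).
Hypothesis forth : forall s t, lab' s t != l0 ->
  exists2 b, lab (p s) b = lab' s t & tp n b = tp n (p t).

Lemma local_hom (S : {set E}) : #|S| <= n -> exists f : E -> D,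
  (forall s, s \in S -> tp (n - #|S|) (f s) = tp (n - #|S|) (p s)) /\
  (forall s t, s \in S -> t \in S -> lab' s t != l0 -> lab (f s) (f t) = lab' s t).
Proof.
move Em: #|S| => m; elim: m S Em => [|m IHm] S Em le_m.
  by exists p; split=> // s t; rewrite (cards0_eq Em) inE.
have [|//|s sS leaf_s] := @exists_leaf S; first by rewrite -card_gt0 Em.
  by rewrite Em.
have Em' : #|S :\ s| = m by move: Em; rewrite (cardsD1 s S) sS => -[].
have [f' [tf' hf']] := IHm _ Em' (ltnW le_m).
have Ek : n - m = (n - m.+1).+1 by lia.
have inS' x : x \in S -> x != s -> x \in S :\ s by rewrite !inE => -> ->.
have ne_sym x y : lab' x y != l0 -> lab' y x != l0.
  by apply: contra_neq => E0; rewrite lab'C E0 inv0.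
have [y ty hy] : exists2 y, tp (n - m.+1) y = tp (n - m.+1) (p s) &
    forall t, t \in S -> lab' t s != l0 -> lab (f' t) y = lab' t s.
  have [/existsP[t /andP[tS ts]]|/existsPn none] := boolP [exists t, (t \in S) && (lab' t s != l0)].
    have t_neq : t != s by apply: contraNneq ts => ->; rewrite lab'_refl.
    have [b lab_b tp_b] := forth ts.
    have := tf' t (inS' t tS t_neq); rewrite Ek => Et.
    have [|y ly ty] := tp_step (x := b) (esym Et).
      by rewrite lab_b.
    exists y; first by rewrite ty; apply: tp_le tp_b; lia.
    move=> t' t'S t's; rewrite (leaf_s t' t) //; try exact: ne_sym.
    by rewrite ly.
  exists (p s) => // t tS ts; have := none t; by rewrite tS ts.
exists (fun x => if x == s then y else f' x); split=> [x xS|x t xS tS xt].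
  have [-> //|xs] := eqVneq x s.
  by apply: (@tp_le _ _ _ _ _ _ _ (n - m)); [lia | apply: tf'; apply: inS'].
have [Ex|xs] := eqVneq x s; have [Et|ts] := eqVneq t s.
- by rewrite Ex Et lab'_refl eqxx in xt.
- rewrite labC hy //; first by rewrite -lab'C Ex.
  by apply: ne_sym; rewrite -Ex.
- by rewrite Et hy // -Et.
by apply: hf' => //; apply: inS'.
Qed.
End Forest.

(** * Bounded countermodels *)

Fixpoint subforms (g : gpform) : seq gpform := g ::
  match g with
  | FU _ _ | FB _ _ _ | FEq _ _ => [::]
  | FNeg f => subforms f
  | FAnd f g => subforms f ++ subforms g
  | FEx vs a f => atom_form a :: subforms f
  | FCount v ts c d => subforms_terms ts
  end
with subforms_terms (ts : pterms) : seq gpform :=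
  match ts with PNil => [::] | PCons _ _ _ f ts => subforms f ++ subforms_terms ts end.

Lemma enc_atom_form a : enc_form (atom_form a) = enc_atom a.
Proof. by case: a. Qed.

Lemma size_subforms :
  (forall g, size (subforms g) <= (enc_form g).+1) /\
  (forall ts, size (subforms_terms ts) <= enc_terms ts).
Proof.
apply: gpform_mutind => //=.
- move=> f IHf; have := leq_cpair 3 (enc_form f); lia.
- move=> f IHf g IHg; rewrite size_cat.
  have := leq_cpair 4 (cpair (enc_form f) (enc_form g)).
  have := leq_cpair (enc_form f) (enc_form g); lia.
- move=> vs a f IHf.
  have := leq_cpair 5 (cpair (enc_list (map enc_var vs)) (cpair (enc_atom a) (enc_form f))).
  have := leq_cpair (enc_list (map enc_var vs)) (cpair (enc_atom a) (enc_form f)).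
  have := leq_cpair (enc_atom a) (enc_form f); lia.
- move=> v ts IHts c d.
  have := leq_cpair 6 (cpair (enc_var v) (cpair (enc_terms ts) (cpair (enc_cmp c) (enc_int d)))).
  have := leq_cpair (enc_var v) (cpair (enc_terms ts) (cpair (enc_cmp c) (enc_int d))).
  have := leq_cpair (enc_terms ts) (cpair (enc_cmp c) (enc_int d)); lia.
move=> lam R inv f IHf ts IHts; rewrite size_cat.
have := leq_cpair (enc_int lam)
  (cpair R (cpair (nat_of_bool inv) (cpair (enc_form f) (enc_terms ts)))).
have := leq_cpair R (cpair (nat_of_bool inv) (cpair (enc_form f) (enc_terms ts))).
have := leq_cpair (nat_of_bool inv) (cpair (enc_form f) (enc_terms ts)).
have := leq_cpair (enc_form f) (enc_terms ts); lia.
Qed.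

Fixpoint lam_sum ts := if ts is PCons lam _ _ _ ts then `|lam| + lam_sum ts else 0.

Lemma leq_enc_int z : `|z| <= enc_int z.
Proof. case: z => n /=; lia. Qed.

Lemma leq_lam_sum ts : lam_sum ts <= enc_terms ts.
Proof.
elim: ts => //= lam R inv f ts IHts; have := leq_enc_int lam.
have := leq_cpair (enc_int lam)
  (cpair R (cpair (nat_of_bool inv) (cpair (enc_form f) (enc_terms ts)))).
have := leq_cpair R (cpair (nat_of_bool inv) (cpair (enc_form f) (enc_terms ts))).
have := leq_cpair (nat_of_bool inv) (cpair (enc_form f) (enc_terms ts)).
have := leq_cpair (enc_form f) (enc_terms ts); lia.
Qed.

(* Every number occurring in a formula, in particular every relation symbol, is
   bounded by its code. *)
Lemma wf_subforms N (Good : gpform -> Prop) :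
  (forall g, enc_form g < N -> is_gf g ->
     (forall h, List.In h (subforms g) -> enc_form h < N -> Good h) -> wf N Good g) /\
  (forall ts, enc_terms ts < N -> is_gf_terms ts ->
     (forall h, List.In h (subforms_terms ts) -> enc_form h < N -> Good h) -> wf_terms N Good ts).
Proof.
apply: gpform_mutind.
- move=> A u lt_N _ G; split; first by apply: G => //; left.
  have := leq_cpair 0 (cpair A (enc_var u)); have := leq_cpair A (enc_var u).
  by move: lt_N => /=; lia.
- move=> R u v lt_N _ G; split; first by apply: G => //; left.
  have := leq_cpair 1 (cpair R (cpair (enc_var u) (enc_var v))).
  have := leq_cpair R (cpair (enc_var u) (enc_var v)).
  by move: lt_N => /=; lia.
- by move=> u v lt_N _ G; split=> //; apply: G => //; left.
- move=> f IHf lt_N gf G; split; first by apply: G => //; left.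
  apply: IHf => // [|h hf]; last by apply: G; right.
  by have := leq_cpair 3 (enc_form f); move: lt_N => /=; lia.
- move=> f IHf g IHg lt_N /andP[gf gg] G; split; first by apply: G => //; left.
  have := leq_cpair 4 (cpair (enc_form f) (enc_form g)).
  have := leq_cpair (enc_form f) (enc_form g).
  move: lt_N => /= *; split; [apply: IHf|apply: IHg] => //; try lia.
    by move=> h hf; apply: G; right; apply/List.in_or_app; left.
  by move=> h hf; apply: G; right; apply/List.in_or_app; right.
- move=> vs a f IHf lt_N /andP[gf /forallP gd] G; split; first by apply: G => //; left.
  have := leq_cpair 5 (cpair (enc_list (map enc_var vs)) (cpair (enc_atom a) (enc_form f))).
  have := leq_cpair (enc_list (map enc_var vs)) (cpair (enc_atom a) (enc_form f)).
  have := leq_cpair (enc_atom a) (enc_form f).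
  move: lt_N => /= lt_N h1 h2 h3; split.
  + by apply: G; [right; left | rewrite enc_atom_form; lia].
  + have : enc_atom a < N by lia.
    case: (a) => [A u|R u v] /=.
      have := leq_cpair 0 (cpair A (enc_var u)); have := leq_cpair A (enc_var u); lia.
    have := leq_cpair 1 (cpair R (cpair (enc_var u) (enc_var v))).
    have := leq_cpair R (cpair (enc_var u) (enc_var v)); lia.
  + by apply: IHf => // [|h hf]; [lia | apply: G; right; right].
  by move=> w; apply/implyP.
- move=> v ts IHts c d lt_N gts G; split; first by apply: G => //; left.
  have := leq_cpair 6 (cpair (enc_var v) (cpair (enc_terms ts) (cpair (enc_cmp c) (enc_int d)))).
  have := leq_cpair (enc_var v) (cpair (enc_terms ts) (cpair (enc_cmp c) (enc_int d))).
  have := leq_cpair (enc_terms ts) (cpair (enc_cmp c) (enc_int d)).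
  move: lt_N => /= *; apply: IHts => // [|h hf]; [lia | by apply: G; right].
- by [].
move=> lam R inv f IHf ts IHts lt_N /andP[gf gts] G.
have := leq_cpair (enc_int lam)
  (cpair R (cpair (nat_of_bool inv) (cpair (enc_form f) (enc_terms ts)))).
have := leq_cpair R (cpair (nat_of_bool inv) (cpair (enc_form f) (enc_terms ts))).
have := leq_cpair (nat_of_bool inv) (cpair (enc_form f) (enc_terms ts)).
have := leq_cpair (enc_form f) (enc_terms ts).
move: lt_N => /= *; split; first lia.
  by apply: IHf => // [|h hf]; [lia | apply: G; apply/List.in_or_app; left].
by apply: IHts => // [|h hf]; [lia | apply: G; apply/List.in_or_app; right].
Qed.

Definition tower_card c l k := iter k (fun x => x * 2 ^ (l * x)) c.
Definition bd_l N := 2 ^ (N * 2).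
Definition bd_p N := tower_card (2 ^ N * 2 ^ N * 2 ^ N) (bd_l N) (N * 2).
Definition bd_j N := N + bd_l N * bd_p N.
Definition bd_c N := (N + N).+1.
Definition bd_a N := sm_A (bd_p N) (bd_l N) (bd_j N) (bd_c N).
Definition bd_h N := bd_a N * bd_l N * bd_p N * sm_W (bd_p N) (bd_l N) (bd_j N) (bd_c N).
(** Elements, two sheets, and the order of the group of permutations of words of length at most
    [N * 2] over the half-edges. *)
Definition bound N := bd_a N * 2 * ((bd_h N).+1 ^ (N * 2))`!.

Lemma card_set_type (T : finType) : #|{: {set T}}| = 2 ^ #|T|.
Proof.
rewrite -[#|T|]cardsT -card_powerset; apply: eq_card => A.
by rewrite !inE; apply/esym/subsetP => x; rewrite inE.
Qed.

Lemma card_tower (C L : finType) k : #|tower C L k| = tower_card #|C| #|L| k.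
Proof.
by elim: k => //= k IHk; rewrite card_prod card_set_type card_prod IHk.
Qed.

Section Countermodel.
Variables (f : gpform) (q : cq) (D : finType) (U : nat -> pred D) (B : nat -> rel D) (N : nat).
Hypotheses (f_lt : enc_form f < N) (q_lt : enc_cq q < N) (f_gf : gf2pres_sentence f).
Hypotheses (D_gt0 : 0 < #|D|) (f_sat : forall e, sat U B e f) (q_unsat : ~ cq_sat U B q).

(** Subformulas indexed by ['I_N] and padded with a formula that is true everywhere. The test on the
    code bounds the numbers inside, see [phi_count]. *)
Let phi (i : 'I_N) : gpform :=
  let h := nth (FEq false false) (subforms f) i in
  if enc_form h < N then h else FEq false false.
Let Good g := exists i, phi i = g.
Let L := label N.
Let C : finType := ({ffun 'I_N -> bool} * {ffun 'I_N -> bool} * {ffun 'I_N -> bool})%type.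
(** Unary predicates and loops are recorded so that query atoms about a single element survive the
    folding. *)
Let color (d : D) : C := ([ffun i => sat U B (fun=> d) (phi i)],
  [ffun A : 'I_N => U A d], [ffun R : 'I_N => B R d d]).
(** The query has fewer than [N] atoms, each with at most two variables. *)
Let n := N * 2.
Let P := tower C L n.
Let lb := lab N B.
Let pi : D -> P := tp set0 color lb n.

Let pi_color a b k : tp set0 color lb k a = tp set0 color lb k b -> color a = color b.
Proof. exact: (@tp_le _ _ _ _ _ _ 0 k a b). Qed.

Let good_pi g a b : Good g -> pi a = pi b -> sat U B (fun=> a) g = sat U B (fun=> b) g.
Proof. by case=> i <- /pi_color [/ffunP/(_ i) + _ _]; rewrite !ffunE. Qed.

Let f_wf : wf N Good f.
Proof.
case/andP: f_gf => gf _; apply: (proj1 (wf_subforms N Good)) => // h hf h_lt.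
have [i lt_i Ei] : exists2 i, i < size (subforms f) & nth (FEq false false) (subforms f) i = h.
  elim: (subforms f) hf => //= g s IHs [->|/IHs[i lt_i Ei]]; first by exists 0.
  by exists i.+1.
have lt_iN : i < N by have := proj1 size_subforms f; lia.
by exists (Ordinal lt_iN); rewrite /phi /= Ei h_lt.
Qed.

(** Besides the counting subformulas, there is a constraint for each label and class that asks for
    the existence of such neighbours; it provides the back and forth conditions. *)
Let J : finType := ('I_N + L * P)%type.
Let cst (j : J) d : int := match j with
  | inl i => if phi i is FCount v ts _ _ then pconst U B d v ts else 0%R
  | inr _ => 0%R end.
Let coef (j : J) d (x : L * P) : int := match j with
  | inl i => if phi i is FCount v ts _ _ then pcoef U B pi d v ts x else 0%R
  | inr y => Posz (y == x) end.
Let cm (j : J) := match j with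
  | inl i => if phi i is FCount _ _ c _ then c else CEq
  | inr _ => CGt end.
Let dl (j : J) : int := match j with
  | inl i => if phi i is FCount _ _ _ delta then delta else 0%R
  | inr _ => 0%R end.

Let phi_count i v ts c delta : phi i = FCount v ts c delta ->
  [/\ lam_sum ts <= N, cmp_modulus c <= N & `|delta| <= N].
Proof.
rewrite /phi; case: ifP => // h_lt Eh; rewrite Eh /= in h_lt.
have := leq_cpair 6 (cpair (enc_var v) (cpair (enc_terms ts) (cpair (enc_cmp c) (enc_int delta)))).
have := leq_cpair (enc_var v) (cpair (enc_terms ts) (cpair (enc_cmp c) (enc_int delta))).
have := leq_cpair (enc_terms ts) (cpair (enc_cmp c) (enc_int delta)).
have := leq_cpair (enc_cmp c) (enc_int delta).
have := leq_lam_sum ts; have := leq_enc_int delta.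
have : cmp_modulus c <= enc_cmp c.
  by case: c {h_lt Eh} => //= d; apply: leq_trans (leq_cpair _ _); apply: leq_addl.
by move=> *; split; lia.
Qed.

Let le_pconst d v ts : `|pconst U B d v ts| <= lam_sum ts.
Proof. by elim: ts => //= lam R inv g ts IHts; case: (_ && _); lia. Qed.

Let le_pcoef d v ts (x : L * P) : `|pcoef U B pi d v ts x| <= lam_sum ts.
Proof. by elim: ts => //= lam R inv g ts IHts; case: (_ && _); lia. Qed.

Let pcoef0 d v ts b : pcoef U B pi d v ts (set0 : L, b) = 0%R.
Proof. by elim: ts => //= lam R inv g ts ->; rewrite in_label0 mulr0 addr0. Qed.

Let linval_support (y : L * P) u : linval 0%R (fun x => Posz (y == x)) u = Posz (u y).
Proof.
rewrite /linval add0r (bigD1 y) //= eqxx mul1r big1 ?addr0 // => x /negPf.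
by rewrite eq_sym => ->; rewrite mul0r.
Qed.

Let inv_set0 : inv_label (set0 : L) = set0.
Proof. by apply/setP => x; rewrite !inE. Qed.

Lemma countermodel_bound : exists (D' : finType) (U' : nat -> pred D') (B' : nat -> rel D'),
  [/\ 0 < #|D'| <= bound N,
      (forall A x, U' A x -> A < N) /\ (forall R x y, B' R x y -> R < N),
      forall e, sat U' B' e f & ~ cq_sat U' B' q].
Proof.
have labC := @labC N D B.
have [||||A [pA [w [cardA leW bal holdsA coverA]]]] :=
  @small_degrees D P L J pi lb (@inv_label N) cst coef cm dl N (@inv_labelK N) labC.
- case=> [i|y] d //=; case E : (phi i) => [|||||| v ts c delta] //=.
  by have [+ _ _] := phi_count E; apply: leq_trans.
- case=> [i|y] d x //=; last by case: (_ == _) => //=; lia.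
  case E : (phi i) => [|||||| v ts c delta] //=.
  by have [+ _ _] := phi_count E; apply: leq_trans.
- case=> [i|y] //=; case E : (phi i) => [|||||| v ts c delta] //=.
  by have [] := phi_count E.
- case=> [i|y] //=; case E : (phi i) => [|||||| v ts c delta] //=.
  by have [] := phi_count E.
have n_gt0 : 0 < n by rewrite /n; lia.
have [E [p0 [lab' [cardE surj [lab'C lab'_refl] degE girth]]]] :=
  @cover_exists A P L (fun a => pi (pA a)) (@inv_label N) set0 w n _ (@inv_labelK N) inv_set0 leW bal n_gt0.
pose p s := pA (p0 s).
pose U' A' s := (A' < N) && U A' (p s).
pose B' R s t := if s == t then (R < N) && B R (p s) (p s) else in_label R false (lab' s t).
have deg_gt0 (T : finType) (pi' : T -> P) (labT : T -> T -> L) d x :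
    0 < deg pi' labT d x <-> exists2 b, labT d b = x.1 & pi' b = x.2.
  rewrite /deg; split=> [/card_gt0P[b]|[b <- <-]].
    by rewrite inE => /andP[/eqP <- /eqP <-]; exists b.
  by apply/card_gt0P; exists b; rewrite inE !eqxx.
have degw s x : x.1 != set0 -> deg (fun t => pi (p t)) lab' s x = w (p0 s) x.1 x.2.
  exact: degE.
have support s x : x.1 != set0 ->
    (0 < deg (fun t => pi (p t)) lab' s x) = (0 < deg pi lb (p s) x).
  move=> /degw ->; have := holdsA (p0 s) (inr x); rewrite /= !linval_support.
  by rewrite -!ltz_nat.
have supportA a d : (forall j, cmp_sat (cm j) (linval (cst j d) (coef j d) (deg pi lb (pA a))) (dl j) =
      cmp_sat (cm j) (linval (cst j d) (coef j d) (deg pi lb d)) (dl j)) ->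
    forall x, (0 < deg pi lb (pA a) x) = (0 < deg pi lb d x).
  by move=> H x; have := H (inr x); rewrite /= !linval_support -!ltz_nat.
have forth s t : lab' s t != set0 -> exists2 b, lb (p s) b = lab' s t & pi b = pi (p t).
  move=> ne; apply/(deg_gt0 _ pi lb _ (lab' s t, pi (p t))).
  by rewrite -support //; apply/deg_gt0; exists t.
have back s b : lb (p s) b != set0 -> exists2 t, lab' s t = lb (p s) b & pi (p t) = pi b.
  move=> ne; apply/(deg_gt0 _ (fun t => pi (p t)) lab' _ (lb (p s) b, pi b)).
  by rewrite support //; apply/deg_gt0; exists b.
have cover a : exists s, pi (p s) = pi a.
  by have [a0 [E0 _]] := coverA a; have [s Es] := surj a0; exists s; rewrite /p Es.
have cover_edge a b : lb a b != set0 ->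
    exists s t, [/\ lab' s t = lb a b, pi (p s) = pi a & pi (p t) = pi b].
  move=> ne; have [a0 [E0 /supportA sup]] := coverA a; have [s Es] := surj a0.
  have /deg_gt0[t lt pt] : 0 < deg (fun t => pi (p t)) lab' s (lb a b, pi b).
    by rewrite support // /p Es sup; apply/deg_gt0; exists b.
  by exists s, t; rewrite /p Es.
have role_edge R inv s t : R < N -> s != t -> role B' R inv s t = in_label R inv (lab' s t).
  move=> _ /negPf st; rewrite /role /B' st eq_sym st; case: inv => //.
  by rewrite lab'C in_inv_label.
have role_loop R inv s : R < N -> role B' R inv s s = role B R inv (p s) (p s).
  by move=> ltR; rewrite /role /B' eqxx ltR; case: inv.
have U'E A' s : A' < N -> U' A' s = U A' (p s) by rewrite /U' => ->.
have same_counts s v ts c delta : Good (FCount v ts c delta) ->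
    cmp_sat c (linval (pconst U B (p s) v ts) (pcoef U B pi (p s) v ts)
                (deg (fun t => pi (p t)) lab' s : L * P -> nat)) delta =
    cmp_sat c (linval (pconst U B (p s) v ts) (pcoef U B pi (p s) v ts) (deg pi lb (p s))) delta.
  case=> i Ei; have := holdsA (p0 s) (inl i); rewrite /coef /= Ei -/(p s) => <-.
  congr (cmp_sat _ (_ + _)%R _); apply: eq_bigr => -[l b] _.
  (* The cover does not control the number of non-neighbours, but their coefficients vanish. *)
  by have [->|ne] := eqVneq l set0; [rewrite pcoef0 !mul0r | rewrite degw].
have psum_D := @psum_self D U B N P pi Good good_pi.
have [/(_ f f_wf) pres _] := preserved_all good_pi role_edge role_loop lab'_refl lab'C
  forth U'E back cover cover_edge same_counts psum_D.
have cardL : #|L| = bd_l N by rewrite card_set_type card_prod card_ord card_bool.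
have cardP : #|P| = bd_p N.
  by rewrite card_tower cardL !card_prod !card_ffun card_bool card_ord.
have cardJ : #|J| = bd_j N by rewrite card_sum card_prod card_ord cardL cardP.
exists E, U', B'; split.
- apply/andP; split.
    have /card_gt0P[d _] := D_gt0; have [s _] := cover d.
    by apply/card_gt0P; exists s.
  rewrite cardE /bound; apply: leq_mul.
    by rewrite leq_mul2r /=; move: cardA; rewrite cardP cardL cardJ -addnn.
  apply/leq_fact/(leq_trans (card_bseq _ _)).
  rewrite -/n leq_exp2r // ltnS.
  have -> : #|{: A * L * P * 'I_(sm_W #|P| #|L| #|J| N.*2.+1)}| =
      #|A| * #|L| * #|P| * sm_W #|P| #|L| #|J| N.*2.+1 by rewrite !card_prod card_ord.
  rewrite cardL cardP cardJ -addnn.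
  rewrite /bd_h !leq_mul2r; apply/orP; right; apply/orP; right; apply/orP; right.
  by move: cardA; rewrite cardP cardL cardJ -addnn.
- split=> [A' s|R s t]; first by case/andP.
  rewrite /B'; case: ifP => _; first by case/andP.
  by case/existsP=> i /andP[/eqP <- _].
- move=> e; case/andP: f_gf => _ /forallP closed.
  rewrite (sat_fv _ _ (e2 := fun=> e false)) => [|v]; last by rewrite (negPf (closed v)).
  by rewrite (pres _ (fun=> p (e false))) //; left.
case=> h Hh; apply: q_unsat.
pose qvars a := match a with QU _ u => [:: u] | QB _ u v => [:: u; v] end.
pose vars := flatten (map qvars q).
pose S := [set x in map h vars].
have le_S : #|S| <= n.
  rewrite /S cardsE (leq_trans (card_size _)) // size_map /n.
  apply: leq_trans (_ : size q * 2 <= _).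
    rewrite /vars; elim: (q) => //= a s IHs; rewrite size_cat mulSn leq_add //.
    by case: a.
  rewrite leq_mul2r /=; apply: ltnW; apply: leq_ltn_trans q_lt.
  by rewrite -(size_map enc_cq_atom) size_enc_list.
have [f0 [f0_tp f0_lab]] := local_hom girth inv_set0 labC lab'C lab'_refl forth le_S.
have colorE s : s \in S -> color (f0 s) = color (p s) by move=> /f0_tp /pi_color.
have varS a u : List.In a q -> u \in qvars a -> h u \in S.
  move=> aq ua; rewrite inE map_f // /vars.
  elim: (q) aq => //= b s IHs [->|/IHs]; first by rewrite mem_cat ua.
  by rewrite mem_cat => ->; rewrite orbT.
exists (fun u => f0 (h u)).
have : forall a, List.In a q -> cq_atom_sat U' B' h a -> cq_atom_sat U B (fun u => f0 (h u)) a.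
  case=> [A' u|R u v] aq /=.
    case/andP=> ltA Uh; have uS : h u \in S by apply: (varS _ _ aq); rewrite inE.
    have [_ /ffunP/(_ (Ordinal ltA)) EU _] := colorE _ uS.
    by move: EU; rewrite !ffunE /= => ->.
  have uS : h u \in S by apply: (varS _ _ aq); rewrite inE eqxx.
  have vS : h v \in S by apply: (varS _ _ aq); rewrite !inE eqxx orbT.
  rewrite /B'; have [<-|uv] := eqVneq (h u) (h v).
    case/andP=> ltR Bh; have [_ _ /ffunP/(_ (Ordinal ltR))] := colorE _ uS.
    by rewrite !ffunE /= => ->.
  move=> inl; have ltR : R < N by case/existsP: inl => i /andP[/eqP <- _].
  have ne : lab' (h u) (h v) != set0 by apply: contraTneq inl => ->; rewrite in_label0.
  have Elab := f0_lab _ _ uS vS ne.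
  have ne0 : f0 (h u) != f0 (h v) by apply: contraNneq ne => E0; rewrite -Elab E0 /lb lab_refl.
  by rewrite -[B R _ _]/(role B R false _ _) (@roleE N) // Elab.
move: Hh; elim: (q) => //= a s IHs /andP[ha hs] imp.
by rewrite imp ?IHs //; auto.
Qed.
End Countermodel.

(** * Computability of the bound and conclusion *)

Lemma hilb_prod m N : hilb m N =
  \prod_(0 <= i < m) (iter i.+1 hstep N * iter i.+1 hstep N).
Proof.
elim: m N => [|m IHm] N; first by rewrite big_geq.
rewrite big_nat_recl //= IHm mulnAC; congr (_ * _); apply: eq_bigr => i _.
by rewrite -!iterS !iterSr.
Qed.

Lemma fact_prod0 n : n`! = \prod_(0 <= i < n) i.+1.
Proof. by rewrite fact_prod big_add1. Qed.

Lemma Cf_fact k F : Cf k F -> Cf k (fun e => (F e)`!).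
Proof.
apply: Cf_app1; apply: (Cf_ext (F := fun e => \prod_(0 <= i < e 0) i.+1)).
  by move=> e; rewrite fact_prod0.
by comp.
Qed.

Lemma Cf_hstep k F : Cf k F -> Cf k (fun e => hstep (F e)).
Proof. by apply: Cf_app1; rewrite /hstep /hbound; comp. Qed.

(** The recursion of [hilb] changes its second argument, which [Cf_rec] does not accommodate; the
    product of iterates does away with this. *)
Lemma Cf_hilb k F G : Cf k F -> Cf k G -> Cf k (fun e => hilb (F e) (G e)).
Proof.
apply: Cf_app2; apply: (Cf_ext (F := fun e =>
    \prod_(0 <= i < e 0) (iter i.+1 hstep (e 1) * iter i.+1 hstep (e 1)))).
  by move=> e; rewrite hilb_prod.
apply: (Cf_prod (F := fun i e => iter i.+1 hstep (e 1) * iter i.+1 hstep (e 1))); first by comp.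
by apply: Cf_mul; apply: (Cf_iter (G := fun x _ => hstep x)); try comp; apply: Cf_hstep; comp.
Qed.

Lemma Cf_bound : Cf 1 (fun e => bound (e 0)).
Proof.
have CV k F G H : Cf k F -> Cf k G -> Cf k H -> Cf k (fun e => sm_V (F e) (G e) (H e)).
  by apply: Cf_app3; rewrite /sm_V; comp.
have CB k F G H I : Cf k F -> Cf k G -> Cf k H -> Cf k I ->
    Cf k (fun e => sm_B1 (F e) (G e) (H e) (I e)).
  by apply: Cf_app4; rewrite /sm_B1; apply: Cf_hilb; [comp | apply: Cf_add; [apply: CV|]; comp].
have CY k F G H I : Cf k F -> Cf k G -> Cf k H -> Cf k I ->
    Cf k (fun e => sm_Y (F e) (G e) (H e) (I e)).
  apply: Cf_app4; rewrite /sm_Y; apply: Cf_exp; last by apply: CV; comp.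
  by apply/Cf_S/CB; comp.
have CK k F G H I : Cf k F -> Cf k G -> Cf k H -> Cf k I ->
    Cf k (fun e => sm_K (F e) (G e) (H e) (I e)).
  apply: Cf_app4; rewrite /sm_K; apply: Cf_mul; first by comp.
  apply: Cf_exp; last by comp.
  apply: Cf_exp; last by apply: CV; comp.
  by apply: (Cf_ext (F := fun e => (e 3 + e 3).+1)) => [e|]; [rewrite addnn | comp].
have CG k F G H I : Cf k F -> Cf k G -> Cf k H -> Cf k I ->
    Cf k (fun e => sm_G (F e) (G e) (H e) (I e)).
  by apply: Cf_app4; apply: Cf_mul; [apply: CK | apply: CY]; comp.
have CM k F G H I : Cf k F -> Cf k G -> Cf k H -> Cf k I ->
    Cf k (fun e => sm_M (F e) (G e) (H e) (I e)).
  apply: Cf_app4; apply: Cf_mul; first by apply: CG; comp.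
  apply: Cf_hilb; first by comp.
  by apply: Cf_add; [apply: CG | apply: CB]; comp.
have CA k F G H I : Cf k F -> Cf k G -> Cf k H -> Cf k I ->
    Cf k (fun e => sm_A (F e) (G e) (H e) (I e)).
  by apply: Cf_app4; apply: Cf_mul; [apply: CG | apply: CM]; comp.
have CW k F G H I : Cf k F -> Cf k G -> Cf k H -> Cf k I ->
    Cf k (fun e => sm_W (F e) (G e) (H e) (I e)).
  apply: Cf_app4; apply: Cf_add; first by apply: CB; comp.
  by apply: Cf_mul; [apply: CY; comp | apply: Cf_mul; [apply: CM | apply: CB]; comp].
have Cl : Cf 1 (fun e => bd_l (e 0)) by rewrite /bd_l; comp.
have Cp' : Cf 1 (fun e => bd_p (e 0)).
  rewrite /bd_p /tower_card.
  apply: (Cf_iter (G := fun x e => x * 2 ^ (bd_l (e 0) * x))); try by comp.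
  apply: Cf_mul; first by comp.
  apply: Cf_exp; first by comp.
  by apply: Cf_mul; [apply: (Cf_app1 Cl) | idtac]; comp.
have Cj : Cf 1 (fun e => bd_j (e 0)).
  by apply: Cf_add; [comp | apply: Cf_mul].
have Cc : Cf 1 (fun e => bd_c (e 0)) by rewrite /bd_c; comp.
have Ca : Cf 1 (fun e => bd_a (e 0)) by apply: CA.
have Ch : Cf 1 (fun e => bd_h (e 0)).
  by apply: Cf_mul; [apply: Cf_mul => //; apply: Cf_mul | apply: CW].
apply: Cf_mul; first by apply: Cf_mul => //; comp.
by apply: Cf_fact; apply: Cf_exp; [apply: Cf_S | comp].
Qed.

Theorem mainTheorem14 :
  exists M : rf, forall (f : gpform) (q : cq),
    gf2pres_sentence f ->
    (finite_entails f q -> eval M [:: enc_form f; enc_cq q] 1) /\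
    (~ finite_entails f q -> eval M [:: enc_form f; enc_cq q] 0).
Proof.
have [M HM] := Cf_decide Cf_bound.
exists M => f q f_gf.
have := HM (fun i => if i is 0 then enc_form f else enc_cq q).
rewrite /mkseq /=; set N := (_ + _).+1.
have f_lt : enc_form f < N by rewrite /N; lia.
have q_lt : enc_cq q < N by rewrite /N; lia.
case E : (counterc _ _ _ _) => evM; split=> //.
  by move=> /(counterc_sound q_lt f_gf E).
(* If the query failed in [D], [countermodel_bound] would give a countermodel within the range of
   the failed search. *)
case=> D U B D_gt0 f_sat; apply: NNPP => q_unsat.
have [D' [U' [B' [le_D' [UN BN] f_sat' q_unsat']]]] :=
  countermodel_bound f_lt q_lt f_gf D_gt0 f_sat q_unsat.
by rewrite (counterc_complete q_lt le_D' UN BN f_sat' q_unsat') in E.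
Qed.
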